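(* Let $(R,\mathfrak m)$ be a Noetherian local ring and $M$ a finite $R$-module of dimension $d>0$. Let $\mathbf x=x_1,\ldots,x_r$ ($0<r\le d$) be a partial system of parameters of $M$ that is a $d$-sequence relative to $M$. Let $S=R[T_1,\ldots,T_r]$ be the polynomial ring. Then there exists a complex of graded $S$-modules, arising by applying the functor $\mathrm H^0_{\mathfrak m}(-)$ to the (augmented) approximation complex $\mathcal M(\mathbf x;M)$, $$0\to \mathrm H^0_{\mathfrak m}(\mathrm H_r(\mathbf x;M))\otimes_R S[-r]\to\cdots\to \mathrm H^0_{\mathfrak m}(\mathrm H_1(\mathbf x;M))\otimes_R S[-1]\to \mathrm H^0_{\mathfrak m}(\mathrm H_0(\mathbf x;M))\otimes_R S\to \mathrm H^0_{\mathfrak m}(\operatorname{gr}_{(\mathbf x)}(M))\to 0.$$ Furthermore, if $\mathbf x$ is amenable to $M$, then the following complex is acyclic (exact): $$0\to \mathrm H_r(\mathbf x;M)\otimes_R S[-r]\to\cdots\to \mathrm H_1(\mathbf x;M)\otimes_R S[-1]\to \mathrm H^0_{\mathfrak m}(\mathrm H_0(\mathbf x;M))\otimes_R S\to \mathrm H^0_{\mathfrak m}(\operatorname{gr}_{(\mathbf x)}(M))\to 0.$$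
   Context: ''Finite'' module means finitely generated. $\mathrm H_i(\mathbf x;M)$ denotes Koszul homology of $M$ with respect to $\mathbf x$, and $\mathrm H^0_{\mathfrak m}(-)$ is the functor of elements annihilated by a power of $\mathfrak m$. A partial system of parameters of $M$ is a sequence $x_1,\ldots,x_r\in\mathfrak m$ with $\dim M=r+\dim M/(x_1,\ldots,x_r)M$. It is amenable to $M$ if $\mathrm H_i(\mathbf x;M)$ has finite length for all $i>0$. A sequence $x_1,\ldots,x_n$ is a $d$-sequence relative to $M$ if $(x_1,\ldots,x_{i-1})M:_M x_ix_j=(x_1,\ldots,x_{i-1})M:_M x_j$ for all $1\le i\le j\le n$. $\operatorname{gr}_I(M)=\bigoplus_{n\ge0}I^nM/I^{n+1}M$. $S$ is standard graded ($\deg T_i=1$, $R$ in degree $0$), and $S[-i]_n=S_{n-i}$. The (augmented) approximation complex $\mathcal M(\mathbf x;M)$ is the complex of graded $S$-modules $$0\to \mathrm H_r(\mathbf x;M)\otimes_R S[-r]\to\cdots\to \mathrm H_1(\mathbf x;M)\otimes_R S[-1]\to \mathrm H_0(\mathbf x;M)\otimes_R S\to\operatorname{gr}_{(\mathbf x)}(M)\to0,$$ whose differentials $\mathrm H_i(\mathbf x;M)\otimes S[-i]\to \mathrm H_{i-1}(\mathbf x;M)\otimes S[-i+1]$ are induced on homology by the Koszul differential of $T_1,\ldots,T_r$ on $\bigwedge R^{r}\otimes M\otimes S$ (which anticommutes with the Koszul differential of $\mathbf x$), and whose augmentation sends $\overline{m}\otimes T_1^{a_1}\cdots T_r^{a_r}$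 (with $\overline m\in M/(\mathbf x)M$) to the class of $x_1^{a_1}\cdots x_r^{a_r}m$ in $(\mathbf x)^{n}M/(\mathbf x)^{n+1}M$, $n=\sum a_i$. Applying $\mathrm H^0_{\mathfrak m}$ uses $\mathrm H^0_{\mathfrak m}(N\otimes_R S)=\mathrm H^0_{\mathfrak m}(N)\otimes_R S$; when $\mathbf x$ is amenable, $\mathrm H^0_{\mathfrak m}(\mathrm H_i(\mathbf x;M))=\mathrm H_i(\mathbf x;M)$ for $i\ge1$, and the second complex is the first one. *)

(* Defs.v *)
From HB Require Import structures.
From mathcomp Require Import all_boot all_order all_algebra.
From mathcomp Require Import boolp.
From mathcomp Require Import mpoly.

Set Implicit Arguments.
Unset Strict Implicit.
Unset Printing Implicit Defensive.

Import GRing.Theory.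
Local Open Scope quotient_scope.
Local Open Scope ring_scope.

Section Submodules.
Variable A : comNzRingType.
Implicit Types V W : lmodType A.

Definition submodP V (P : V -> Prop) :=
  P 0 /\ forall (a : A) u v, P u -> P v -> P (a *: u + v).

Definition submod_pred V (P : V -> Prop) (_ : submodP P) : {pred V} :=
  fun v => `[< P v >].

Lemma submod_pred_closed V (P : V -> Prop) (hP : submodP P) :
  GRing.submod_closed (submod_pred hP).
Proof.
case: (hP) => P0 PD; split; first exact/asboolP.
by move=> a u v /asboolP Pu /asboolP Pv; apply/asboolP/PD.
Qed.

HB.instance Definition _ V (P : V -> Prop) (hP : submodP P) :=
  GRing.isSubmodClosed.Build A V (submod_pred hP) (submod_pred_closed hP).

Definition mksub V (P : V -> Prop) (hP : submodP P) : submodClosed V :=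
  submod_pred hP.

Lemma mksubP V (P : V -> Prop) (hP : submodP P) v :
  reflect (P v) (v \in mksub hP).
Proof. exact: asboolP. Qed.

Lemma submodPT V : submodP (fun _ : V => True).
Proof. by []. Qed.
Definition sub_full V := mksub (@submodPT V).

Lemma submodP_span V (X : V -> Prop) :
  submodP (fun v => forall N : submodClosed V,
             (forall u, X u -> u \in N) -> v \in N).
Proof.
split=> [N _|a u v hu hv N hN]; first exact: rpred0.
by apply: rpredD; [apply: rpredZ; apply: hu | apply: hv].
Qed.
Definition span V (X : V -> Prop) : submodClosed V := mksub (submodP_span X).

Lemma mem_span V (X : V -> Prop) v : X v -> v \in span X.
Proof. by move=> Xv; apply/mksubP => N; apply. Qed.

Lemma span_min V (X : V -> Prop) (N : submodClosed V) :
  (forall u, X u -> u \in N) -> forall v, v \in span X -> v \in N.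
Proof. by move=> h v /mksubP; apply. Qed.

(* An ideal is a submodule of the regular module. *)
Definition idealT : Type := submodClosed A^o.

Definition scale_sub V (I : idealT) (N : submodClosed V) : submodClosed V :=
  span (fun v => exists a u, [/\ a \in (I : {pred A^o}), u \in N & v = a *: u]).

(* I^n V *)
Definition pow_sub V (I : idealT) (n : nat) : submodClosed V :=
  iter n (scale_sub I) (sub_full V).

Lemma submodP_comap V W (f : {linear V -> W}) (N : submodClosed W) :
  submodP (fun v => f v \in N).
Proof.
split=> [|a u v hu hv]; first by rewrite linear0 rpred0.
by rewrite linearP rpredD // rpredZ.
Qed.
Definition comap V W (f : {linear V -> W}) (N : submodClosed W) :=
  mksub (submodP_comap f N).

Lemma submodP_image V W (f : {linear V -> W}) (N : submodClosed V) :
  submodP (fun w => exists2 v, v \in N & w = f v).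
Proof.
split=> [|a _ _ [u hu ->] [v hv ->]]; first by exists 0; rewrite ?rpred0 ?linear0.
by exists (a *: u + v); rewrite ?linearP // rpredD // rpredZ.
Qed.
Definition image_sub V W (f : {linear V -> W}) (N : submodClosed V) :=
  mksub (submodP_image f N).

Definition subm V (N : submodClosed V) : Type := {v : V | v \in N}.

HB.instance Definition _ V (N : submodClosed V) := SubChoice.on (subm N).
HB.instance Definition _ V (N : submodClosed V) :=
  [SubChoice_isSubLmodule of subm N by <:].

Lemma submodN V (N : submodClosed V) v : v \in N -> - v \in N.
Proof. by move=> hv; rewrite -scaleN1r rpredZ. Qed.

Lemma submodB V (N : submodClosed V) u v : u \in N -> v \in N -> u - v \in N.
Proof. by move=> hu hv; rewrite rpredD // submodN. Qed.

(* The library quotient asks for a [zmodClosed], which a [submodClosed] over a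
   ring is, but not canonically. *)
Definition zpred V (N : submodClosed V) : {pred V} := fun v => v \in N.

Lemma zpred_closed V (N : submodClosed V) : zmod_closed (zpred N).
Proof. by split=> [|u v]; [exact: rpred0 | exact: submodB]. Qed.

HB.instance Definition _ V (N : submodClosed V) :=
  GRing.isZmodClosed.Build V (zpred N) (zpred_closed N).

Definition quom V (N : submodClosed V) : Type := Quotient.quot (zpred N).

HB.instance Definition _ V (N : submodClosed V) := GRing.Zmodule.on (quom N).

Section QuotientModule.
Variables (V : lmodType A) (N : submodClosed V).

Definition quom_pi (v : V) : quom N := \pi_(Quotient.quot (zpred N)) v.

Lemma quom_piE u v : (quom_pi u = quom_pi v) <-> u - v \in N.
Proof.
have -> : (u - v \in N) = (u - v \in zpred N) by [].
by rewrite Quotient.idealrBE; split=> /eqP.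
Qed.

Lemma quom_pi_surj (q : quom N) : exists v, q = quom_pi v.
Proof. by exists (repr (q : Quotient.quot (zpred N))); rewrite /quom_pi reprK. Qed.

Lemma quom_piD u v : quom_pi (u + v) = quom_pi u + quom_pi v.
Proof. exact: (raddfD (\pi_(Quotient.quot (zpred N)) : {additive V -> _})). Qed.

Definition quom_scale (a : A) (q : quom N) : quom N :=
  quom_pi (a *: repr (q : Quotient.quot (zpred N))).

Lemma quom_piZ a v : quom_pi (a *: v) = quom_scale a (quom_pi v).
Proof.
apply/quom_piE; rewrite -scalerBr; apply: rpredZ.
by apply/quom_piE; rewrite /quom_pi reprK.
Qed.

Fact quom_scaleA a b q : quom_scale a (quom_scale b q) = quom_scale (a * b) q.
Proof. by have [v ->] := quom_pi_surj q; rewrite -!quom_piZ scalerA. Qed.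
Fact quom_scale1 : left_id 1 quom_scale.
Proof. by move=> q; have [v ->] := quom_pi_surj q; rewrite -!quom_piZ scale1r. Qed.
Fact quom_scaleDr : right_distributive quom_scale +%R.
Proof.
move=> a p q; have [u ->] := quom_pi_surj p; have [v ->] := quom_pi_surj q.
by rewrite -quom_piD -!quom_piZ scalerDr quom_piD.
Qed.
Fact quom_scaleDl q : {morph quom_scale^~ q : a b / a + b}.
Proof.
move=> a b; have [v ->] := quom_pi_surj q.
by rewrite -!quom_piZ scalerDl quom_piD.
Qed.

HB.instance Definition _ := GRing.Zmodule_isLmodule.Build A (quom N)
  quom_scaleA quom_scale1 quom_scaleDr quom_scaleDl.

Fact quom_pi_linear : linear quom_pi.
Proof. by move=> a u v; rewrite quom_piD quom_piZ. Qed.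
HB.instance Definition _ := GRing.isLinear.Build A V (quom N) *:%R quom_pi
  quom_pi_linear.
End QuotientModule.

(* The quotient Z / (Z :&: B). *)
Definition subquo V (Z B : submodClosed V) : Type :=
  quom (comap (val : {linear subm Z -> V}) B).
HB.instance Definition _ V (Z B : submodClosed V) := GRing.Lmodule.on (subquo Z B).

Definition cls V (Z B : submodClosed V) (z : V) (hz : z \in Z) : subquo Z B :=
  quom_pi _ (exist _ z hz : subm Z).

Lemma clsE V (Z B : submodClosed V) (u v : V) (hu : u \in Z) (hv : v \in Z) :
  cls B hu = cls B hv <-> u - v \in B.
Proof.
rewrite /cls quom_piE; split=> [/mksubP|h]; first by rewrite raddfB.
by apply/mksubP; rewrite raddfB.
Qed.

Lemma clsP V (Z B : submodClosed V) (q : subquo Z B) : exists (z : V) (hz : z \in Z), q = cls B hz.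
Proof. by have [[z hz] ->] := quom_pi_surj q; exists z, hz. Qed.

Section Subquotient.
Variables (V W : lmodType A) (Z B : submodClosed V) (Z' B' : submodClosed W).
Variable f : {linear V -> W}.
Hypothesis fZ : forall v, v \in Z -> f v \in Z'.
Hypothesis fB : forall v, v \in B -> f v \in B'.

Definition subquo_repr (q : subquo Z B) : subm Z :=
  repr (q : Quotient.quot _).

Lemma subquo_reprK q : cls B (valP (subquo_repr q)) = q.
Proof.
rewrite /cls; set z := exist _ _ _.
have -> : z = subquo_repr q by apply: val_inj.
exact: reprK.
Qed.

Definition subquo_map_fun (q : subquo Z B) : subquo Z' B' :=
  cls B' (fZ (valP (subquo_repr q))).

Lemma subquo_map_cls z (hz : z \in Z) :
  subquo_map_fun (cls B hz) = cls B' (fZ hz).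
Proof.
apply/clsE; rewrite -raddfB; apply: fB.
by have /clsE := subquo_reprK (cls B hz).
Qed.

Lemma subquo_map_linear : linear subquo_map_fun.
Proof.
move=> a p q; have [u [hu ->]] := clsP p; have [v [hv ->]] := clsP q.
have hw : a *: u + v \in Z by rewrite rpredD ?rpredZ.
have -> : a *: cls B hu + cls B hv = cls B hw.
  by rewrite /cls -linearP; congr quom_pi; apply: val_inj.
rewrite !subquo_map_cls /cls -linearP; congr quom_pi.
by apply: val_inj; rewrite /= linearP.
Qed.
End Subquotient.

Definition subquo_map V W (Z B : submodClosed V) (Z' B' : submodClosed W)
  (f : {linear V -> W}) (fZ : forall v, v \in Z -> f v \in Z')
  (fB : forall v, v \in B -> f v \in B') : subquo Z B -> subquo Z' B' :=
  subquo_map_fun B' fZ.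
HB.instance Definition _ V W (Z B : submodClosed V) (Z' B' : submodClosed W)
  (f : {linear V -> W}) (fZ : forall v, v \in Z -> f v \in Z')
  (fB : forall v, v \in B -> f v \in B') :=
  GRing.isLinear.Build A (subquo Z B) (subquo Z' B') *:%R (subquo_map fZ fB)
    (subquo_map_linear fZ fB).

End Submodules.

Section DirectSum.
Variables (A : comNzRingType) (I : choiceType) (N : I -> lmodType A).

Record dsum := DSum {
  ds_val :> forall i, N i;
  ds_finite : exists s : seq I, forall i, i \notin s -> ds_val i = 0 }.

Lemma dsum_ext (f g : dsum) : (forall i, f i = g i) -> f = g.
Proof.
case: f g => [f hf] [g hg] /= fg; have e : f = g by apply: functional_extensionality_dep.
by case: _ / e hg => hg; congr DSum; exact: Prop_irrelevance.
Qed.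

HB.instance Definition _ := gen_eqMixin dsum.
HB.instance Definition _ := gen_choiceMixin dsum.

Fact ds_zero_fin : exists s : seq I, forall i, i \notin s -> (0 : N i) = 0.
Proof. by exists [::]. Qed.
Definition ds_zero := DSum ds_zero_fin.

Fact ds_add_fin (f g : dsum) :
  exists s : seq I, forall i, i \notin s -> f i + g i = 0.
Proof.
have [[s hs] [t ht]] := (ds_finite f, ds_finite g); exists (s ++ t) => i.
by rewrite mem_cat negb_or => /andP[/hs -> /ht ->]; rewrite addr0.
Qed.
Definition ds_add f g := DSum (ds_add_fin f g).

Fact ds_scale_fin (a : A) (f : dsum) :
  exists s : seq I, forall i, i \notin s -> a *: f i = 0.
Proof. by have [s hs] := ds_finite f; exists s => i /hs ->; rewrite scaler0. Qed.
Definition ds_scale a f := DSum (ds_scale_fin a f).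
Definition ds_opp := ds_scale (-1).

Fact ds_addA : associative ds_add.
Proof. by move=> f g h; apply: dsum_ext => i /=; rewrite addrA. Qed.
Fact ds_addC : commutative ds_add.
Proof. by move=> f g; apply: dsum_ext => i /=; rewrite addrC. Qed.
Fact ds_add0 : left_id ds_zero ds_add.
Proof. by move=> f; apply: dsum_ext => i /=; rewrite add0r. Qed.
Fact ds_addN : left_inverse ds_zero ds_opp ds_add.
Proof. by move=> f; apply: dsum_ext => i /=; rewrite scaleN1r addNr. Qed.
HB.instance Definition _ :=
  GRing.isZmodule.Build dsum ds_addA ds_addC ds_add0 ds_addN.

Fact ds_scaleA a b f : ds_scale a (ds_scale b f) = ds_scale (a * b) f.
Proof. by apply: dsum_ext => i /=; rewrite scalerA. Qed.
Fact ds_scale1 : left_id 1 ds_scale.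
Proof. by move=> f; apply: dsum_ext => i /=; rewrite scale1r. Qed.
Fact ds_scaleDr : right_distributive ds_scale +%R.
Proof. by move=> a f g; apply: dsum_ext => i /=; rewrite scalerDr. Qed.
Fact ds_scaleDl f : {morph ds_scale^~ f : a b / a + b}.
Proof. by move=> a b; apply: dsum_ext => i /=; rewrite scalerDl. Qed.
HB.instance Definition _ := GRing.Zmodule_isLmodule.Build A dsum
  ds_scaleA ds_scale1 ds_scaleDr ds_scaleDl.

Lemma ds0E i : (0 : dsum) i = 0. Proof. by []. Qed.
Lemma dsDE (f g : dsum) i : (f + g) i = f i + g i. Proof. by []. Qed.
Lemma dsZE a (f : dsum) i : (a *: f) i = a *: f i. Proof. by []. Qed.
Lemma ds_sumE (J : Type) (s : seq J) (F : J -> dsum) i :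
  (\sum_(j <- s) F j) i = \sum_(j <- s) F j i.
Proof. by elim: s => [|j s IH]; rewrite ?big_nil ?big_cons // dsDE IH. Qed.

Definition ds_in_val i (v : N i) j : N j :=
  if i =P j is ReflectT e then ecast k (N k) e v else 0.

Fact ds_in_fin i (v : N i) :
  exists s : seq I, forall j, j \notin s -> ds_in_val v j = 0.
Proof.
by exists [:: i] => j; rewrite inE eq_sym /ds_in_val; case: eqP.
Qed.
Definition ds_in i (v : N i) := DSum (ds_in_fin v).

Lemma ds_inE i (v : N i) : ds_in v i = v.
Proof. by rewrite /= /ds_in_val; case: eqP => // e; rewrite eq_axiomK. Qed.

Lemma ds_inN i j (v : N i) : i != j -> ds_in v j = 0.
Proof. by rewrite /= /ds_in_val; case: eqP. Qed.

Fact ds_in_linear i : linear (@ds_in i).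
Proof.
move=> a u v; apply: dsum_ext => j; rewrite dsDE dsZE.
have [<-|ne] := eqVneq i j; first by rewrite !ds_inE.
by rewrite !ds_inN // scaler0 addr0.
Qed.
HB.instance Definition _ i :=
  GRing.isLinear.Build A (N i) dsum *:%R (@ds_in i) (@ds_in_linear i).

Definition ds_supp (f : dsum) : seq I := undup (projT1 (cid (ds_finite f))).

Lemma ds_suppN f i : i \notin ds_supp f -> f i = 0.
Proof. by rewrite mem_undup; case: cid => s /= h /h. Qed.

Section Lift.
Variables (W : lmodType A) (g : forall i, {linear N i -> W}).

Definition ds_lift (f : dsum) : W := \sum_(i <- ds_supp f) g i (f i).

Lemma ds_liftE (f : dsum) (s : seq I) : uniq s ->
  (forall i, i \notin s -> f i = 0) -> ds_lift f = \sum_(i <- s) g i (f i).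
Proof.
move=> us hs; rewrite /ds_lift.
rewrite (bigID (fun i => f i != 0)) /= [X in _ + X]big1 ?addr0; last first.
  by move=> i; rewrite negbK => /eqP ->; rewrite linear0.
rewrite [RHS](bigID (fun i => f i != 0)) /= [X in _ + X]big1 ?addr0; last first.
  by move=> i; rewrite negbK => /eqP ->; rewrite linear0.
rewrite -big_filter -[RHS]big_filter; apply: perm_big.
apply: uniq_perm; rewrite ?filter_uniq ?undup_uniq // => i.
rewrite !mem_filter; have [//|nz] := eqVneq (f i) 0; rewrite /=.
transitivity true; last apply/esym.
  by apply: contraNT nz => /ds_suppN ->.
by apply: contraNT nz => /hs ->.
Qed.

Fact ds_lift_linear : linear ds_lift.
Proof.
move=> a f h; pose s := undup (ds_supp f ++ ds_supp h).
have us : uniq s by apply: undup_uniq.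
have hf i : i \notin s -> f i = 0.
  by rewrite mem_undup mem_cat negb_or => /andP[/ds_suppN].
have hh i : i \notin s -> h i = 0.
  by rewrite mem_undup mem_cat negb_or => /andP[_ /ds_suppN].
rewrite (ds_liftE us hf) (ds_liftE us hh) (@ds_liftE _ s) //; last first.
  by move=> i his; rewrite dsDE dsZE hf // hh // scaler0 addr0.
rewrite scaler_sumr -big_split; apply: eq_bigr => i _.
by rewrite dsDE dsZE linearP.
Qed.
HB.instance Definition _ :=
  GRing.isLinear.Build A dsum W *:%R ds_lift ds_lift_linear.

Lemma ds_lift_in i (v : N i) : ds_lift (ds_in v) = g i v.
Proof.
rewrite (@ds_liftE _ [:: i]) ?big_seq1 ?ds_inE // => j.
by rewrite inE eq_sym => /ds_inN ->.
Qed.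
End Lift.

Lemma ds_decomp (f : dsum) : f = \sum_(i <- ds_supp f) ds_in (f i).
Proof.
apply: dsum_ext => i; rewrite ds_sumE.
have [hi|hi] := boolP (i \in ds_supp f).
  rewrite (bigD1_seq i) ?undup_uniq // ds_inE big1 /= ?addr0 // => j ji.
  exact: ds_inN.
rewrite (ds_suppN hi) big1_seq // => j /= hj; apply: ds_inN.
by apply: contraNneq hi => <-.
Qed.

Lemma ds_ind (P : dsum -> Prop) : P 0 -> (forall f g, P f -> P g -> P (f + g)) ->
  (forall i (v : N i), P (ds_in v)) -> forall f, P f.
Proof. by move=> P0 PD Pin f; rewrite [f]ds_decomp; apply: big_ind. Qed.

Lemma ds_linear_ext (W : lmodType A) (g h : {linear dsum -> W}) :
  (forall i (v : N i), g (ds_in v) = h (ds_in v)) -> g =1 h.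
Proof.
move=> gh; apply: ds_ind => [|f1 f2 e1 e2|//]; first by rewrite !linear0.
by rewrite !linearD e1 e2.
Qed.
End DirectSum.

Section PolynomialModule.
Variables (A : comNzRingType) (r : nat) (V : lmodType A).
Variable T : 'I_r -> {linear V -> V}.
Hypothesis TC : forall k l v, T k (T l v) = T l (T k v).

Definition xact (a : 'X_{1..r}) (v : V) : V :=
  foldr (fun k w => iter (a k) (T k) w) v (enum 'I_r).

Definition pact (p : {mpoly A[r]}) (v : V) : V :=
  \sum_(a <- msupp p) p@_a *: xact a v.

Fact iter_linear k n : linear (iter n (T k)).
Proof. by elim: n => [|n IH] a u v //=; rewrite IH linearP. Qed.

Fact xact_linear a : linear (xact a).
Proof.
rewrite /xact; elim: (enum _) => [|k s IH] b u v //=.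
by rewrite IH iter_linear.
Qed.

Fact iterTC k l n m v : iter n (T k) (iter m (T l) v) = iter m (T l) (iter n (T k) v).
Proof.
have one w : T k (iter m (T l) w) = iter m (T l) (T k w).
  by elim: m => //= m <-; rewrite TC.
by elim: n => //= n ->; rewrite one.
Qed.

Fact xact_add a : {morph xact a : u v / u + v}.
Proof. by move=> u v; rewrite -{1}[u]scale1r xact_linear scale1r. Qed.

Fact xact_0 a : xact a 0 = 0.
Proof. by apply: (@addIr _ (xact a 0)); rewrite -xact_add !add0r. Qed.

Fact xactD a b v : xact (a + b)%MM v = xact a (xact b v).
Proof.
rewrite /xact; elim: (enum _) => //= k s IH.
rewrite IH mnmDE iterD; congr iter.
move: (foldr _ v s) => w; elim: s {IH} => //= l s <-; by rewrite iterTC.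
Qed.

Fact xact0 v : xact 0%MM v = v.
Proof. by rewrite /xact; elim: (enum _) => //= k s ->; rewrite mnm0E. Qed.

Fact xact1 k v : xact U_(k)%MM v = T k v.
Proof.
have h (s : seq 'I_r) : uniq s -> foldr (fun l w => iter (U_(k)%MM l) (T l) w) v s =
   if k \in s then T k v else v.
  elim: s => //= l s IH /andP[hl /IH ->]; rewrite mnm1E inE.
  by have [->|] := eqVneq k l; rewrite /= ?(negPf hl).
by rewrite /xact h ?enum_uniq // mem_enum.
Qed.

Fact pactE p v (s : seq 'X_{1..r}) : uniq s -> {subset msupp p <= s} ->
  pact p v = \sum_(a <- s) p@_a *: xact a v.
Proof.
move=> us sub; rewrite [RHS](bigID (mem (msupp p))) /= [X in _ + X]big1 ?addr0.
  rewrite -[RHS]big_filter /pact; apply: perm_big.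
  apply: uniq_perm; rewrite ?msupp_uniq ?filter_uniq // => a.
  by rewrite mem_filter andb_idr //; exact: sub.
by move=> a /memN_msupp_eq0 ->; rewrite scale0r.
Qed.

Fact pactDl v : {morph pact^~ v : p q / p + q}.
Proof.
move=> p q; pose s := undup (msupp p ++ msupp q).
have us : uniq s by apply: undup_uniq.
rewrite (@pactE p v s) // 1?(@pactE q v s) // 1?(@pactE (p + q) v s) //.
- by rewrite -big_split; apply: eq_bigr => a _; rewrite mcoeffD scalerDl.
- by move=> a /msuppD_le; rewrite mem_undup.
- by move=> a h; rewrite mem_undup mem_cat h orbT.
- by move=> a h; rewrite mem_undup mem_cat h.
Qed.

Fact pactDr : right_distributive pact +%R.
Proof.
move=> p u v; rewrite /pact -big_split; apply: eq_bigr => a _.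
by rewrite xact_add scalerDr.
Qed.

Fact pact0 v : pact 0 v = 0.
Proof. by rewrite /pact msupp0 big_nil. Qed.

Fact pactX c a v : pact (c *: 'X_[a]) v = c *: xact a v.
Proof.
rewrite (@pactE _ v [:: a]) //; last first.
  by move=> b /msuppZ_le; rewrite msuppX.
by rewrite big_seq1 mcoeffZ mcoeffX eqxx mulr1.
Qed.

Fact pactZ c p v : pact (c *: p) v = c *: pact p v.
Proof.
rewrite (@pactE _ v (msupp p)) ?msupp_uniq //; last exact: msuppZ_le.
by rewrite scaler_sumr; apply: eq_bigr => a _; rewrite mcoeffZ scalerA.
Qed.

Fact xactZ c a v : xact a (c *: v) = c *: xact a v.
Proof.
have := xact_linear a c v 0; rewrite addr0 => ->.
by rewrite xact_0 addr0.
Qed.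

Fact pactZr c p v : pact p (c *: v) = c *: pact p v.
Proof.
rewrite /pact scaler_sumr; apply: eq_bigr => a _.
by rewrite xactZ !scalerA mulrC.
Qed.

Fact pact_sum (J : Type) (s : seq J) (F : J -> {mpoly A[r]}) v :
  pact (\sum_(j <- s) F j) v = \sum_(j <- s) pact (F j) v.
Proof. exact: (big_morph (pact^~ v) (pactDl v) (pact0 v)). Qed.

Fact pact_sumr (J : Type) (s : seq J) p (F : J -> V) :
  pact p (\sum_(j <- s) F j) = \sum_(j <- s) pact p (F j).
Proof.
apply: (big_morph (pact p) (pactDr p)).
by rewrite -[0 in LHS](scale0r (0 : V)) pactZr scale0r.
Qed.

Fact pactA p q v : pact p (pact q v) = pact (p * q) v.
Proof.
rewrite [p]mpolyE mulr_suml !pact_sum; apply: eq_bigr => a _.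
rewrite [q]mpolyE mulr_sumr !pact_sum pact_sumr; apply: eq_bigr => b _.
rewrite !pactX xactZ -scalerAl -scalerAr -mpolyXD -xactD !scalerA.
by rewrite pactX.
Qed.

Fact pact1 : left_id 1 pact.
Proof.
move=> v; have -> : 1 = 1 *: 'X_[0%MM] :> {mpoly A[r]} by rewrite mpolyX0 scale1r.
by rewrite pactX scale1r xact0.
Qed.

(* [V] as a module over the polynomial ring, the variables acting by [T]. *)
Definition polymod of (forall k l v, T k (T l v) = T l (T k v)) : Type := V.
Local Notation PV := (polymod TC).
HB.instance Definition _ := GRing.Zmodule.on PV.
HB.instance Definition _ := GRing.Zmodule_isLmodule.Build {mpoly A[r]} PV
  pactA pact1 pactDr pactDl.

Lemma polymodC (c : A) (v : PV) : c%:MP_[r] *: v = c *: (v : V) :> V.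
Proof.
have -> : c%:MP_[r] = c *: 'X_[0%MM] by rewrite mpolyX0 -mul_mpolyC mulr1.
by rewrite [LHS]pactX xact0.
Qed.

Lemma polymodX (k : 'I_r) (v : PV) : ('X_k : {mpoly A[r]}) *: v = T k v :> V.
Proof.
by rewrite -[X in X *: _]scale1r [LHS]pactX xact1 scale1r.
Qed.
End PolynomialModule.

(* Graded modules over R[T_1, ..., T_r] in nonnegative degrees; [gm_deg n] is the
   degree n component. *)
Section GradedModules.
Variables (R : comNzRingType) (r : nat).
Local Notation S := {mpoly R[r]}.

Record is_grading (V : lmodType S) (deg : nat -> V -> Prop) : Prop := IsGrading {
  deg0 : forall n, deg n 0;
  degB : forall n u v, deg n u -> deg n v -> deg n (u - v);
  degZ : forall k n (p : S) v, p \is k.-homog -> deg n v -> deg (k + n)%N (p *: v);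
  deg_decomp : forall v, exists (b : nat) (c : nat -> V),
    (forall n, deg n (c n)) /\ v = \sum_(n < b) c n;
  deg_uniq : forall (b : nat) (c : nat -> V), (forall n, deg n (c n)) ->
    \sum_(n < b) c n = 0 -> forall n, (n < b)%N -> c n = 0 }.

Record grmod := GrMod {
  gm_car :> lmodType S;
  gm_deg : nat -> gm_car -> Prop;
  gm_grading : is_grading gm_deg }.

Record ghom (V W : grmod) := GHom {
  gh_fun :> {linear V -> W};
  gh_deg : forall n v, gm_deg n v -> gm_deg n (gh_fun v) }.

Record gcomplex (C : nat -> grmod) := GComplex {
  gc_d :> forall j, ghom (C j.+1) (C j);
  gc_dd : forall j v, gc_d j (gc_d j.+1 v) = 0 }.

(* Exactness of 0 -> C (n + 1) -> C n -> ... -> C 0 -> 0. *)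
Definition acyclic (n : nat) (C : nat -> grmod) (K : gcomplex C) : Prop :=
  [/\ forall w : C 0, exists v, K 0 v = w,
      forall j, (j < n)%N -> forall v : C j.+1, K j v = 0 -> exists w, v = K j.+1 w
    & injective (K n)].

(* A direct sum of R-modules N_i, with N_i placed in degree wt i, on which the
   variables act by commuting endomorphisms of degree 1. *)
Record gsum_data := GSumData {
  gs_I : choiceType;
  gs_wt : gs_I -> nat;
  gs_N : gs_I -> lmodType R;
  gs_T : 'I_r -> {linear dsum gs_N -> dsum gs_N};
  gs_TC : forall k l v, gs_T k (gs_T l v) = gs_T l (gs_T k v);
  gs_Twt : forall k i (v : gs_N i) j,
    gs_wt j != (gs_wt i).+1 -> gs_T k (ds_in v) j = 0 }.

Section GSum.
Variable D : gsum_data.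
Local Notation V := (polymod (@gs_TC D)).

Definition gs_deg (n : nat) (f : dsum (@gs_N D)) : Prop :=
  forall i, gs_wt i != n -> f i = 0.

Fact gs_degD n f g : gs_deg n f -> gs_deg n g -> gs_deg n (f + g).
Proof. by move=> hf hg i hi; rewrite dsDE hf ?hg ?addr0. Qed.

Fact gs_degZ n c f : gs_deg n f -> gs_deg n (c *: f).
Proof. by move=> hf i hi; rewrite dsZE hf ?scaler0. Qed.

Fact gs_degN n f : gs_deg n f -> gs_deg n (- f).
Proof. by move=> hf; rewrite -scaleN1r; apply: gs_degZ. Qed.

Fact gs_deg_sum n (J : eqType) (s : seq J) (F : J -> dsum (@gs_N D)) :
  (forall j, j \in s -> gs_deg n (F j)) -> gs_deg n (\sum_(j <- s) F j).
Proof.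
move=> h; rewrite big_seq; apply: (big_ind (gs_deg n)) => [i _ //||j]; last exact: h.
by move=> f g; apply: gs_degD.
Qed.

Fact gs_deg_T k n f : gs_deg n f -> gs_deg n.+1 (@gs_T D k f).
Proof.
move=> hf; rewrite [f]ds_decomp linear_sum; apply: gs_deg_sum => i _.
have [e|ne] := eqVneq (gs_wt i) n; last by rewrite hf // !linear0 => j _.
by move=> j hj; apply: gs_Twt; rewrite e.
Qed.

Fact gs_deg_xact a n f : gs_deg n f -> gs_deg (mdeg a + n) (xact (@gs_T D) a f).
Proof.
rewrite /xact mdegE -big_enum /= => hf; elim: (enum _) => [|k s IH] /=.
  by rewrite big_nil.
rewrite big_cons -addnA; elim: (a k) => //= b; exact: gs_deg_T.
Qed.

Definition gs_restr_val n (f : dsum (@gs_N D)) i : gs_N i :=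
  if gs_wt i == n then f i else 0.
Fact gs_restr_fin n (f : dsum (@gs_N D)) :
  exists s : seq (gs_I D), forall i, i \notin s -> gs_restr_val n f i = 0.
Proof.
have [s hs] := ds_finite f; exists s => i /hs e.
by rewrite /gs_restr_val e if_same.
Qed.
Definition gs_restr n f := DSum (gs_restr_fin n f).

Fact gsum_grading : is_grading (V := V) gs_deg.
Proof.
split.
- by move=> n i _.
- by move=> n u v hu hv; exact: gs_degD hu (gs_degN hv).
- move=> k n p v /dhomogP hp hv; apply: gs_deg_sum => a ha; apply: gs_degZ.
  by rewrite -(hp _ ha); apply: gs_deg_xact.
- move=> f; exists (\max_(i <- ds_supp f) (gs_wt i)).+1, (gs_restr^~ f); split.
    by move=> n i; rewrite /= /gs_restr_val => /negPf ->.
  apply: dsum_ext => i; rewrite [RHS](ds_sumE _ (fun n : 'I_ _ => gs_restr n f)) /=.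
  rewrite /gs_restr_val; have [hi|hi] := boolP (i \in ds_supp f); last first.
    by rewrite (ds_suppN hi) big1 // => n _; case: ifP.
  have lt : (gs_wt i < (\max_(i <- ds_supp f) (gs_wt i)).+1)%N.
    by rewrite ltnS; apply: leq_bigmax_seq.
  rewrite (bigD1 (Ordinal lt)) //= eqxx big1 ?addr0 // => n.
  by rewrite -val_eqE /= eq_sym => /negPf ->.
- move=> b c hc e n hn; apply: dsum_ext => i.
  have [ei|ne] := eqVneq (gs_wt i) n; last by rewrite hc.
  have := congr1 (fun f : dsum _ => f i) e.
  rewrite (ds_sumE _ (fun n : 'I_ _ => c n)) /= (bigD1 (Ordinal hn)) //= big1.
    by rewrite addr0.
  move=> m; rewrite -val_eqE /= => nm; apply: hc.
  by rewrite ei eq_sym.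
Qed.

Definition gsum : grmod := @GrMod V gs_deg gsum_grading.
End GSum.

Section GSumHom.
Variables (D E : gsum_data) (f : {linear dsum (@gs_N D) -> dsum (@gs_N E)}).
Hypothesis fT : forall k i (v : gs_N i),
  f (@gs_T D k (ds_in v)) = @gs_T E k (f (ds_in v)).
Hypothesis fwt : forall i (v : gs_N i) j,
  gs_wt j != gs_wt i -> f (ds_in v) j = 0.

Definition gsum_fun (v : gsum D) : gsum E := f v.

Fact gsum_fun_linear : linear gsum_fun.
Proof.
have fT' k v : f (@gs_T D k v) = @gs_T E k (f v).
  move: v; apply: ds_ind => [|u v eu ev|i v]; rewrite ?linear0 ?linearD //.
  by rewrite eu ev.
have fX a v : f (xact (@gs_T D) a v) = xact (@gs_T E) a (f v).
  rewrite /xact; elim: (enum _) => //= k s <-.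
  by elim: (a k) => //= n <-.
move=> p u v; rewrite /gsum_fun [LHS]linearD; congr (_ + _).
rewrite [LHS](linear_sum f) [RHS]/GRing.scale /= /pact; apply: eq_bigr => a _.
by rewrite linearZ fX.
Qed.
HB.instance Definition _ :=
  GRing.isLinear.Build S (gsum D) (gsum E) *:%R gsum_fun gsum_fun_linear.

Fact gsum_fun_deg n (v : gsum D) : gm_deg n v -> gm_deg n (gsum_fun v).
Proof.
move=> hv; rewrite /gsum_fun [v]ds_decomp linear_sum; apply: gs_deg_sum => i _.
have [e|ne] := eqVneq (gs_wt i) n; last by rewrite hv // !linear0 => j _.
by move=> j hj; apply: fwt; rewrite e.
Qed.

Definition gsum_hom : ghom (gsum D) (gsum E) := GHom gsum_fun_deg.
End GSumHom.

Section Tensor.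
Definition mon_in (N : lmodType R) (a : 'X_{1..r}) :
    {linear N -> dsum (fun _ : 'X_{1..r} => N)} :=
  @ds_in R _ (fun _ : 'X_{1..r} => N) a.

Variable s : nat.

Definition tens_T (N : lmodType R) (k : 'I_r) :
    {linear dsum (fun _ : 'X_{1..r} => N) -> dsum (fun _ : 'X_{1..r} => N)} :=
  @ds_lift R _ (fun _ : 'X_{1..r} => N) _ (fun a => mon_in N (a + U_(k))%MM).

Fact tens_T_in (N : lmodType R) k a (v : N) :
  tens_T N k (mon_in N a v) = mon_in N (a + U_(k))%MM v.
Proof. exact: ds_lift_in. Qed.

Fact tens_TC (N : lmodType R) k l v :
  tens_T N k (tens_T N l v) = tens_T N l (tens_T N k v).
Proof.
move: v; apply: ds_ind => [|u v eu ev|a v]; rewrite ?linear0 //.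
  by rewrite !linearD eu ev.
by rewrite !tens_T_in -!addmA (addmC U_(l)%MM).
Qed.

Fact tens_xact (N : lmodType R) a b (v : N) :
  xact (tens_T N) a (mon_in N b v) = mon_in N (b + a)%MM v.
Proof.
move: b; rewrite [a]multinomUE_id.
apply: (big_ind (fun a => forall b,
  xact (tens_T N) a (mon_in N b v) = mon_in N (b + a)%MM v)) => [b|a1 a2 h1 h2 b|k _].
- by rewrite xact0 addm0.
- by rewrite xactD ?h2 ?h1 -?addmA 1?(addmC a2) //; exact: tens_TC.
elim: (a k) => [|n IH] b; first by rewrite xact0 addm0.
rewrite mulmS xactD; last exact: tens_TC.
by rewrite IH xact1 tens_T_in -addmA (addmC U_(k)%MM).
Qed.

Fact tens_Twt (N : lmodType R) k a (v : N) b :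
  (mdeg b + s)%N != (mdeg a + s).+1 -> tens_T N k (mon_in N a v) b = 0.
Proof.
move=> h; rewrite tens_T_in ds_inN //; apply: contraNneq h => <-.
by rewrite mdegD mdeg1 addn1.
Qed.

(* The graded S-module N (x)_R S[-s]: as S is free over R on the monomials T^a,
   N (x)_R S is the direct sum of the N (x) T^a, and N (x) T^a is placed in
   degree |a| + s. *)
Definition tens_data (N : lmodType R) : gsum_data :=
  GSumData (@tens_TC N) (@tens_Twt N).
Definition tens (N : lmodType R) : grmod := gsum (tens_data N).

(* The element v (x) T^a. *)
Definition tens_in (N : lmodType R) (a : 'X_{1..r}) (v : N) : tens N :=
  mon_in N a v.

Section TensMap.
Variables (N N' : lmodType R) (g : {linear N -> N'}).

Fact tens_map_lin a : linear (fun v : N => mon_in N' a (g v)).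
Proof. by move=> c u v; rewrite !linearP. Qed.
Definition tens_map_in a (v : N) := mon_in N' a (g v).
HB.instance Definition _ a := GRing.isLinear.Build R N _ *:%R (tens_map_in a)
  (tens_map_lin a).
Definition tens_map_fun : {linear dsum (fun _ : 'X_{1..r} => N) ->
    dsum (fun _ : 'X_{1..r} => N')} :=
  @ds_lift R _ (fun _ : 'X_{1..r} => N) _ tens_map_in.

Fact tens_map_funE a (v : N) : tens_map_fun (mon_in N a v) = mon_in N' a (g v).
Proof. exact: ds_lift_in. Qed.

Fact tens_mapT k a (v : N) :
  tens_map_fun (tens_T N k (mon_in N a v)) =
  tens_T N' k (tens_map_fun (mon_in N a v)).
Proof. by rewrite tens_T_in !tens_map_funE tens_T_in. Qed.

Fact tens_map_wt a (v : N) b : (mdeg b + s)%N != (mdeg a + s)%N ->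
  tens_map_fun (mon_in N a v) b = 0.
Proof.
by move=> h; rewrite tens_map_funE ds_inN //; apply: contraNneq h => ->.
Qed.

Definition tens_map : ghom (tens N) (tens N') :=
  @gsum_hom (tens_data N) (tens_data N') tens_map_fun tens_mapT tens_map_wt.

Lemma tens_map_inE a (v : N) : tens_map (tens_in a v) = tens_in a (g v).
Proof. exact: tens_map_funE. Qed.
End TensMap.
End Tensor.
End GradedModules.

Section Koszul.
Variables (R : comNzRingType) (r : nat) (x : 'I_r -> R) (M : lmodType R).

(* The exterior algebra of R^r tensored with M; [f J] is the coordinate on
   e_J = e_{j1} /\ ... /\ e_{ji}, where J = {j1 < ... < ji}. *)
Definition koszul : Type := {ffun {set 'I_r} -> M}.
HB.instance Definition _ := GRing.Lmodule.on koszul.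

Lemma koszulDE (f g : koszul) J : (f + g) J = f J + g J.
Proof. exact: ffunE. Qed.
Lemma koszulZE c (f : koszul) J : (c *: f) J = c *: f J.
Proof. exact: ffunE. Qed.
Lemma koszul0E J : (0 : koszul) J = 0.
Proof. exact: ffunE. Qed.
Lemma koszulNE (f : koszul) J : (- f) J = - f J.
Proof. exact: ffunE. Qed.
Lemma koszul_sumE (T : Type) (s : seq T) (F : T -> koszul) J :
  (\sum_(t <- s) F t) J = \sum_(t <- s) F t J.
Proof. by elim: s => [|t s IH]; rewrite ?big_nil ?big_cons ?koszul0E // koszulDE IH. Qed.

(* Contraction with the k-th dual basis vector: e_J (x) m is sent to
   (-1)^(p-1) e_{J \ k} (x) m when k is the p-th element of J, and to 0 when k
   is not in J. *)
Definition ksign (k : 'I_r) (J : {set 'I_r}) : R :=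
  (-1) ^+ #|[set l in J | (l < k)%N]|.

Definition contr (k : 'I_r) (f : koszul) : koszul :=
  [ffun J : {set 'I_r} => if k \in J then 0 else ksign k J *: f (k |: J)].

Fact contr_linear k : linear (contr k).
Proof.
move=> c f g; apply/ffunP => J; rewrite koszulDE koszulZE !ffunE.
case: ifP => _; first by rewrite scaler0 addr0.
by rewrite scalerDr !scalerA mulrC.
Qed.
HB.instance Definition _ k :=
  GRing.isLinear.Build R koszul koszul *:%R (contr k) (contr_linear k).

Definition kdiff (f : koszul) : koszul := \sum_(k < r) x k *: contr k f.

Fact kdiff_linear : linear kdiff.
Proof.
move=> c f g; rewrite /kdiff scaler_sumr -big_split; apply: eq_bigr => k _ /=.
by rewrite linearP scalerDr !scalerA mulrC.
Qed.
HB.instance Definition _ :=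
  GRing.isLinear.Build R koszul koszul *:%R kdiff kdiff_linear.

Fact contr_contr k l f : contr k (contr l f) = - contr l (contr k f).
Proof.
apply/ffunP => J; rewrite koszulNE !ffunE !in_setU1.
have [->|nkl] := eqVneq k l.
  by case: ifP; rewrite ?scaler0 oppr0.
rewrite /=; case: ifP => hk; case: ifP => hl;
  rewrite ?scaler0 ?oppr0 //= !scalerA setUCA -scaleNr; congr (_ *: _).
wlog lt : k l nkl hk hl / (k < l)%N => [W|].
  have [/W|gt] := ltnP k l; first exact.
  have lt : (l < k)%N by rewrite ltn_neqAle gt andbT eq_sym; exact: nkl.
  by rewrite (W l k) ?opprK // eq_sym.
have -> : ksign k (l |: J) = ksign k J.
  congr (_ ^+ _); apply: eq_card => i; rewrite !inE.
  by case: eqP => // ->; rewrite hl /= ltnNge ltnW.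
have -> : ksign l (k |: J) = - ksign l J; last by rewrite mulrN mulrC.
rewrite /ksign; have -> : [set i in k |: J | (i < l)%N] = k |: [set i in J | (i < l)%N].
  by apply/setP => i; rewrite !inE; case: eqP => // ->; rewrite lt.
by rewrite cardsU1 !inE hk /= exprS mulN1r.
Qed.

Fact kdiff_contr k f : kdiff (contr k f) = - contr k (kdiff f).
Proof.
rewrite /kdiff linear_sum -sumrN; apply: eq_bigr => l _.
by rewrite linearZ contr_contr scalerN.
Qed.

(* [ksupp i] is the degree i part of the Koszul complex. *)
Fact submodP_ksupp i :
  submodP (fun f : koszul => forall J : {set 'I_r}, #|J| != i -> f J = 0).
Proof.
split=> [J _|c f g hf hg J hJ]; first exact: koszul0E.
by rewrite koszulDE koszulZE hf ?hg // scaler0 addr0.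
Qed.
Definition ksupp i : submodClosed koszul := mksub (submodP_ksupp i).

Fact submodP_kcycle i : submodP (fun f : koszul => f \in ksupp i /\ kdiff f = 0).
Proof.
split=> [|c f g [hf df] [hg dg]]; first by rewrite rpred0 linear0.
by rewrite rpredD ?rpredZ // linearP /= df dg scaler0 addr0.
Qed.
Definition kcycle i : submodClosed koszul := mksub (submodP_kcycle i).

Definition kbound i : submodClosed koszul := image_sub kdiff (ksupp i.+1).

Definition khom (i : nat) : lmodType R := subquo (kcycle i) (kbound i).

Lemma khom_gt i (h : khom i) : (r < i)%N -> h = 0.
Proof.
move=> ri; have [z [hz ->]] := clsP h.
have z0 : z = 0.
  have /mksubP[/mksubP hs _] := hz; apply/ffunP => J; rewrite koszul0E hs //.
  by rewrite neq_ltn (leq_ltn_trans (max_card _)) // card_ord.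
by rewrite -[RHS](linear0 (quom_pi _)); apply/clsE; rewrite z0 subr0 rpred0.
Qed.

Fact contr_supp k i f : f \in ksupp i.+1 -> contr k f \in ksupp i.
Proof.
move=> /mksubP hf; apply/mksubP => J hJ; rewrite ffunE; case: ifPn => // hk.
by rewrite hf ?scaler0 // cardsU1 hk.
Qed.

Fact contr_cycle k i f : f \in kcycle i.+1 -> contr k f \in kcycle i.
Proof.
move=> /mksubP[hf df]; apply/mksubP; split; first exact: contr_supp.
by rewrite kdiff_contr df linear0 oppr0.
Qed.

Fact contr_bound k i f : f \in kbound i.+1 -> contr k f \in kbound i.
Proof.
move=> /mksubP[g hg ->]; apply/mksubP; exists (- contr k g).
  by rewrite submodN // contr_supp.
transitivity (- kdiff (contr k g)); first by rewrite kdiff_contr opprK.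
by rewrite [RHS]linearN.
Qed.

Definition kcontr (k : 'I_r) (i : nat) : {linear khom i.+1 -> khom i} :=
  subquo_map (@contr_cycle k i) (@contr_bound k i).

Lemma kcontr_cls k i z (hz : z \in kcycle i.+1) :
  kcontr k i (cls _ hz) = cls _ (contr_cycle k hz).
Proof. exact: (subquo_map_cls (@contr_cycle k i) (@contr_bound k i)). Qed.

Lemma kcontr_kcontr k l i (h : khom i.+2) :
  kcontr k i (kcontr l i.+1 h) = - kcontr l i (kcontr k i.+1 h).
Proof.
have [z [hz ->]] := clsP h; rewrite !kcontr_cls /cls -linearN; congr quom_pi.
by apply: val_inj; rewrite raddfN /= contr_contr.
Qed.

(* The differential H_{i+1} (x) S[-i-1] -> H_i (x) S[-i] of the approximation
   complex, induced by the Koszul differential of T_1, ..., T_r, which is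
   a |-> sum_k T_k contr_k(a). *)
Section ApproxDiff.
Variable i : nat.

Definition apx_d_in (a : 'X_{1..r}) (h : khom i.+1) :
    dsum (fun _ : 'X_{1..r} => khom i) :=
  \sum_(k < r) mon_in (khom i) (a + U_(k))%MM (kcontr k i h).

Fact apx_d_in_linear a : linear (apx_d_in a).
Proof.
move=> c u v; rewrite /apx_d_in scaler_sumr -big_split; apply: eq_bigr => k _.
by rewrite !linearP.
Qed.
HB.instance Definition _ a :=
  GRing.isLinear.Build R (khom i.+1) _ *:%R (apx_d_in a) (apx_d_in_linear a).

Definition apx_d_fun : {linear dsum (fun _ : 'X_{1..r} => khom i.+1) ->
    dsum (fun _ : 'X_{1..r} => khom i)} :=
  @ds_lift R _ (fun _ : 'X_{1..r} => khom i.+1) _ apx_d_in.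

Fact apx_d_funE a h : apx_d_fun (mon_in _ a h) = apx_d_in a h.
Proof. exact: ds_lift_in. Qed.

Fact apx_dT k a (h : khom i.+1) :
  apx_d_fun (tens_T _ k (mon_in _ a h)) = tens_T _ k (apx_d_fun (mon_in _ a h)).
Proof.
rewrite tens_T_in !apx_d_funE /apx_d_in linear_sum; apply: eq_bigr => l _.
by rewrite tens_T_in -!addmA (addmC U_(k)%MM).
Qed.

Fact apx_d_wt a (h : khom i.+1) b : (mdeg b + i)%N != (mdeg a + i.+1)%N ->
  apx_d_fun (mon_in _ a h) b = 0.
Proof.
move=> hb; rewrite apx_d_funE /apx_d_in ds_sumE big1 // => k _.
rewrite ds_inN //; apply: contraNneq hb => <-.
by rewrite mdegD mdeg1 addn1 addnS.
Qed.

Definition apx_d : ghom (tens r i.+1 (khom i.+1)) (tens r i (khom i)) :=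
  @gsum_hom R r (tens_data r i.+1 (khom i.+1)) (tens_data r i (khom i))
    apx_d_fun apx_dT apx_d_wt.
End ApproxDiff.

Lemma apx_d_inE i a (h : khom i.+1) :
  apx_d i (tens_in i.+1 a h) = \sum_(k < r) tens_in i (a + U_(k))%MM (kcontr k i h).
Proof. exact: apx_d_funE. Qed.

Fact antisym_sum0 (V : zmodType) (F : 'I_r -> 'I_r -> V) :
  (forall k, F k k = 0) -> (forall k l, F k l = - F l k) ->
  \sum_(k < r) \sum_(l < r) F k l = 0.
Proof.
move=> F0 FN; have e k : \sum_(l < r) F k l =
    \sum_(l < r | (l < k)%N) F k l + \sum_(l < r | (k < l)%N) F k l.
  rewrite (bigID (fun l : 'I_r => (l < k)%N)) /=; congr (_ + _).
  rewrite (bigD1 k) ?ltnn //= F0 add0r; apply: eq_bigl => l.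
  by rewrite -leqNgt ltn_neqAle andbC eq_sym.
rewrite (eq_bigr _ (fun k _ => e k)) big_split /=.
rewrite [X in _ + X](exchange_big_dep predT) //= -big_split big1 //= => k _.
by rewrite -big_split big1 // => l _ /=; rewrite FN addNr.
Qed.

Fact kcontr_diag k i (h : khom i.+2) : kcontr k i (kcontr k i.+1 h) = 0.
Proof.
have [z [hz ->]] := clsP h; rewrite !kcontr_cls.
rewrite -[RHS](linear0 (quom_pi _)); apply/clsE; rewrite subr0.
have -> : contr k (contr k z) = 0; last exact: rpred0.
by apply/ffunP => J; rewrite !ffunE setU11 scaler0 if_same.
Qed.

Lemma apx_dd i v : apx_d i (apx_d i.+1 v) = 0.
Proof.
move: v; apply: ds_ind => [|u v eu ev|a h]; first by rewrite !linear0.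
  by rewrite (linearD (apx_d i.+1)) (linearD (apx_d i)) eu ev addr0.
rewrite [X in apx_d i X](apx_d_inE a h) linear_sum.
rewrite (eq_bigr _ (fun k _ => apx_d_inE _ _)).
apply: antisym_sum0 => [k|k l]; first by rewrite kcontr_diag /tens_in linear0.
by rewrite kcontr_kcontr /tens_in linearN -!addmA (addmC U_(l)%MM).
Qed.

(* gr_I(M), for I = (x_1, ..., x_r), is a graded S-module: T_k acts as
   multiplication by x_k from I^n M / I^(n+1) M to I^(n+1) M / I^(n+2) M. *)
Definition xideal : idealT R := span (fun c : R^o => exists k, c = x k).

Definition gr_piece (n : nat) : lmodType R :=
  subquo (pow_sub M xideal n) (pow_sub M xideal n.+1).

Lemma mem_xideal k : x k \in (xideal : {pred R^o}).
Proof. by apply: mem_span; exists k. Qed.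

Fact mulx_pow k n v : v \in pow_sub M xideal n -> x k *: v \in pow_sub M xideal n.+1.
Proof. by move=> hv; apply: mem_span; exists (x k), v; rewrite mem_xideal. Qed.

Definition scalem (c : R) (v : M) : M := c *: v.
Fact scalem_linear c : linear (scalem c).
Proof. by move=> a u v; rewrite /scalem scalerDr !scalerA mulrC. Qed.
HB.instance Definition _ c :=
  GRing.isLinear.Build R M M *:%R (scalem c) (scalem_linear c).

Definition gr_mulx k n : {linear gr_piece n -> gr_piece n.+1} :=
  subquo_map (f := scalem (x k)) (@mulx_pow k n) (@mulx_pow k n.+1).

Definition gr_T_in k n (q : gr_piece n) : dsum gr_piece := ds_in (gr_mulx k n q).
Fact gr_T_in_linear k n : linear (gr_T_in k (n := n)).
Proof. by move=> c u v; rewrite /gr_T_in !linearP. Qed.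
HB.instance Definition _ k n :=
  GRing.isLinear.Build R (gr_piece n) _ *:%R (@gr_T_in k n) (@gr_T_in_linear k n).

Definition gr_T k : {linear dsum gr_piece -> dsum gr_piece} := ds_lift (@gr_T_in k).

Fact gr_T_inE k n (q : gr_piece n) : gr_T k (ds_in q) = ds_in (gr_mulx k n q).
Proof. exact: ds_lift_in. Qed.

Fact gr_mulx_cls k n v (hv : v \in pow_sub M xideal n) :
  gr_mulx k n (cls _ hv) = cls _ (mulx_pow k hv).
Proof. exact: (subquo_map_cls (f := scalem (x k)) (@mulx_pow k n) (@mulx_pow k n.+1)). Qed.

Fact gr_in_eq n n' v v' (hv : v \in pow_sub M xideal n)
    (hv' : v' \in pow_sub M xideal n') : n = n' -> v = v' ->
  ds_in (cls _ hv : gr_piece n) = ds_in (cls _ hv' : gr_piece n').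
Proof.
move=> en ev; case: _ / en hv' => hv'; case: _ / ev hv' => hv'.
by rewrite (bool_irrelevance hv' hv).
Qed.

Fact gr_TC k l v : gr_T k (gr_T l v) = gr_T l (gr_T k v).
Proof.
move: v; apply: ds_ind => [|u v eu ev|n q]; rewrite ?linear0 //.
  by rewrite !linearD eu ev.
have [v [hv ->]] := clsP q; rewrite !gr_T_inE !gr_mulx_cls.
by apply: gr_in_eq; rewrite // !scalerA mulrC.
Qed.

Fact gr_Twt k n (q : gr_piece n) j : j != n.+1 -> gr_T k (ds_in q) j = 0.
Proof. by move=> hj; rewrite gr_T_inE ds_inN // eq_sym. Qed.

Definition gr_data : gsum_data R r := @GSumData R r nat id gr_piece gr_T gr_TC gr_Twt.
Definition gr : grmod R r := gsum gr_data.

(* The augmentation H_0(x; M) (x) S -> gr, where H_0(x; M) is M / (x)M through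
   f |-> f set0. *)
Definition xmon (a : 'X_{1..r}) : R := \prod_(k < r) x k ^+ a k.

Definition aug0 (a : 'X_{1..r}) (f : koszul) : M := xmon a *: f set0.
Fact aug0_linear a : linear (aug0 a).
Proof.
by move=> c f g; rewrite /aug0 koszulDE koszulZE scalerDr !scalerA mulrC.
Qed.
HB.instance Definition _ a :=
  GRing.isLinear.Build R koszul M *:%R (aug0 a) (aug0_linear a).

Fact xmon_pow a n v : v \in pow_sub M xideal n ->
  xmon a *: v \in pow_sub M xideal (mdeg a + n).
Proof.
rewrite /xmon mdegE -!big_enum /= => hv.
elim: (enum _) => [|k s IH]; first by rewrite !big_nil scale1r.
rewrite !big_cons -scalerA -addnA; elim: (a k) => [|b hb]; first by rewrite scale1r.
by rewrite exprS -scalerA; apply: mulx_pow.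
Qed.

Fact aug_cycle a f : f \in kcycle 0 -> aug0 a f \in pow_sub M xideal (mdeg a).
Proof.
by move=> _; rewrite -[mdeg a]addn0; apply: xmon_pow; apply/mksubP.
Qed.

Fact aug_bound a f : f \in kbound 0 -> aug0 a f \in pow_sub M xideal (mdeg a).+1.
Proof.
move=> /mksubP[g _ ->]; rewrite -addn1; apply: xmon_pow.
rewrite /kdiff koszul_sumE; apply: rpred_sum => k _; rewrite koszulZE.
by apply: mulx_pow; apply/mksubP.
Qed.

Definition aug_in (a : 'X_{1..r}) (h : khom 0) : dsum gr_piece :=
  @ds_in R _ gr_piece (mdeg a)
    (subquo_map (f := aug0 a) (@aug_cycle a) (@aug_bound a) h).
Fact aug_in_linear a : linear (aug_in a).
Proof. by move=> c u v; rewrite /aug_in !linearP. Qed.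
HB.instance Definition _ a :=
  GRing.isLinear.Build R (khom 0) _ *:%R (aug_in a) (aug_in_linear a).

Definition aug_fun : {linear dsum (fun _ : 'X_{1..r} => khom 0) -> dsum gr_piece} :=
  @ds_lift R _ (fun _ : 'X_{1..r} => khom 0) _ aug_in.

Fact aug_funE a h : aug_fun (mon_in _ a h) = aug_in a h.
Proof. exact: ds_lift_in. Qed.

Fact aug_inE a z (hz : z \in kcycle 0) :
  aug_in a (cls _ hz) = ds_in (cls _ (aug_cycle a hz) : gr_piece _).
Proof.
by congr ds_in; exact: (subquo_map_cls (f := aug0 a) (@aug_cycle a) (@aug_bound a)).
Qed.

Fact xmonU a k : xmon (a + U_(k))%MM = x k * xmon a.
Proof.
rewrite /xmon (bigD1 k) //= [in RHS](bigD1 k) //= mnmDE mnm1E eqxx addn1 exprS -mulrA.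
congr (_ * (_ * _)); apply: eq_bigr => l lk.
by rewrite mnmDE mnm1E eq_sym (negPf lk) addn0.
Qed.

Fact augT k a (h : khom 0) :
  aug_fun (tens_T _ k (mon_in _ a h)) = gr_T k (aug_fun (mon_in _ a h)).
Proof.
rewrite tens_T_in !aug_funE; have [z [hz ->]] := clsP h.
rewrite !aug_inE gr_T_inE gr_mulx_cls; apply: gr_in_eq.
  by rewrite mdegD mdeg1 addn1.
by rewrite /scalem /= /aug0 xmonU scalerA.
Qed.

Fact aug_wt a (h : khom 0) n : n != (mdeg a + 0)%N -> aug_fun (mon_in _ a h) n = 0.
Proof. by rewrite addn0 => hn; rewrite aug_funE ds_inN // eq_sym. Qed.

Definition aug : ghom (tens r 0 (khom 0)) gr :=
  @gsum_hom R r (tens_data r 0 (khom 0)) gr_data aug_fun augT aug_wt.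

Fact cls_sum (V : lmodType R) (Z B : submodClosed V) (z : 'I_r -> V) (hz : forall k, z k \in Z)
   (hs : \sum_(k < r) z k \in Z) :
  \sum_(k < r) cls B (hz k) = cls B hs.
Proof.
rewrite /cls -linear_sum; congr quom_pi; apply: val_inj.
by rewrite raddf_sum.
Qed.

Lemma aug_d v : aug (apx_d 0 v) = 0.
Proof.
move: v; apply: ds_ind => [|u v eu ev|a h]; first by rewrite !linear0.
  by rewrite (linearD (apx_d 0)) (linearD aug) eu ev addr0.
rewrite [X in aug X](apx_d_inE a h) linear_sum.
have [z [hz ->]] := clsP h.
have hk k : scalem (x k) (aug0 a (contr k z)) \in pow_sub M xideal (mdeg a).+1.
  exact: mulx_pow (aug_cycle a (contr_cycle k hz)).
have s0 : \sum_(k < r) scalem (x k) (aug0 a (contr k z)) = 0.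
  transitivity (aug0 a (kdiff z)).
    rewrite /kdiff linear_sum; apply: eq_bigr => k _.
    by rewrite [RHS]linearZ.
  by have /mksubP[_ ->] := hz; rewrite linear0.
have hs : \sum_(k < r) scalem (x k) (aug0 a (contr k z)) \in pow_sub M xideal (mdeg a).+1.
  by rewrite s0 rpred0.
transitivity (\sum_(k < r) ds_in (cls _ (hk k) : gr_piece _)).
  apply: eq_bigr => k _; rewrite [LHS]aug_funE kcontr_cls aug_inE.
  apply: gr_in_eq; first by rewrite mdegD mdeg1 addn1.
  by rewrite /scalem /= /aug0 xmonU scalerA.
have c0 : cls _ hs = 0 :> gr_piece (mdeg a).+1.
  rewrite -[RHS](linear0 (quom_pi _)); apply/clsE.
  by rewrite s0 subr0 rpred0.
by rewrite -linear_sum (cls_sum _ _ hs) c0 linear0.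
Qed.

(* The augmented approximation complex; C 0 = gr and C (i + 1) = H_i (x) S[-i],
   which vanishes for i > r by [khom_gt]. *)
Definition apx_term (j : nat) : grmod R r :=
  if j is i.+1 then tens r i (khom i) else gr.

Definition apx_diff (j : nat) : ghom (apx_term j.+1) (apx_term j) :=
  if j is i.+1 then apx_d i else aug.

Fact apx_diffK j v : apx_diff j (apx_diff j.+1 v) = 0.
Proof. by case: j v => [|j] v; [exact: aug_d | exact: apx_dd]. Qed.

Definition approx_complex : gcomplex apx_term := GComplex apx_diffK.
End Koszul.

Section Restriction.
Variables (R : comNzRingType) (r : nat) (W : lmodType {mpoly R[r]}).

Definition restr : Type := W.
HB.instance Definition _ := GRing.Zmodule.on restr.
Definition restr_scale (c : R) (w : restr) : restr := c%:MP_[r] *: (w : W).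
Fact restr_scaleA a b w : restr_scale a (restr_scale b w) = restr_scale (a * b) w.
Proof. by rewrite /restr_scale scalerA -mpolyCM. Qed.
Fact restr_scale1 : left_id 1 restr_scale.
Proof. by move=> w; rewrite /restr_scale mpolyC1 scale1r. Qed.
Fact restr_scaleDr : right_distributive restr_scale +%R.
Proof. by move=> a u v; rewrite /restr_scale scalerDr. Qed.
Fact restr_scaleDl w : {morph restr_scale^~ w : a b / a + b}.
Proof. by move=> a b; rewrite /restr_scale mpolyCD scalerDl. Qed.
HB.instance Definition _ := GRing.Zmodule_isLmodule.Build R restr
  restr_scaleA restr_scale1 restr_scaleDr restr_scaleDl.

Lemma restrZ c (w : restr) : c *: w = c%:MP_[r] *: (w : W).
Proof. by []. Qed.

(* [tens] has the universal property of the base change to the polynomial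
   ring. *)
Section BaseChange.
Variables (N : lmodType R) (s : nat) (g : {linear N -> restr}).

Definition bc_in (a : 'X_{1..r}) (v : N) : restr := 'X_[a] *: (g v : W).
Fact bc_in_linear a : linear (bc_in a).
Proof.
move=> c u v; rewrite /bc_in linearP [LHS]scalerDr; congr (_ + _).
by rewrite !restrZ !scalerA mulrC.
Qed.
HB.instance Definition _ a :=
  GRing.isLinear.Build R N restr *:%R (bc_in a) (bc_in_linear a).

Definition bc_fun (f : tens r s N) : W :=
  @ds_lift R _ (fun _ : 'X_{1..r} => N) restr bc_in f.

Let bcL : {linear dsum (fun _ : 'X_{1..r} => N) -> restr} :=
  @ds_lift R _ (fun _ : 'X_{1..r} => N) restr bc_in.

Fact bc_mon a v : bcL (mon_in N a v) = 'X_[a] *: (g v : W).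
Proof. exact: ds_lift_in. Qed.

Fact bc_xact a f : bcL (xact (tens_T N) a f) = 'X_[a] *: (bcL f : W).
Proof.
move: f; apply: ds_ind => [|u v eu ev|b v].
- by rewrite xact_0 linear0 scaler0.
- by rewrite xact_add !linearD eu ev.
by rewrite tens_xact !bc_mon scalerA -mpolyXD addmC.
Qed.

Fact bc_linear : linear bc_fun.
Proof.
move=> p u v; rewrite [LHS](linearD bcL); congr (_ + _).
rewrite [p in RHS]mpolyE scaler_suml [LHS](linear_sum bcL).
apply: eq_bigr => a _; rewrite [LHS]linearZ -mul_mpolyC -scalerA.
by congr (_ *: _); exact: bc_xact.
Qed.

Lemma tens_universal :
  exists G : {linear tens r s N -> W},
    (forall v, G (tens_in s 0%MM v) = g v) /\
    (forall G' : {linear tens r s N -> W},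
       (forall v, G' (tens_in s 0%MM v) = g v) -> G' =1 G).
Proof.
pose L := GRing.isLinear.Build _ (tens r s N) W *:%R bc_fun bc_linear.
pose G : {linear tens r s N -> W} := HB.pack bc_fun L.
have hG v : G (tens_in s 0%MM v) = g v.
  by rewrite [LHS]bc_mon mpolyX0 scale1r.
exists G; split=> // G' hG'.
apply: ds_ind => [|u v eu ev|a v]; first by rewrite !linear0.
  by rewrite (linearD G') (linearD G) eu ev.
have -> : (ds_in v : tens r s N) = ('X_[a] : {mpoly R[r]}) *: tens_in s 0%MM (v : N).
  rewrite -[X in X *: _]scale1r [RHS]pactX scale1r [RHS]tens_xact add0m.
  by [].
by rewrite !linearZ hG' hG.
Qed.
End BaseChange.
End Restriction.

Section LocalCohomology.
Variables (R : comNzRingType) (m : idealT R).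

Definition ideal_pow (k : nat) : idealT R := pow_sub R^o m k.

Fact pow_sub_anti (V : lmodType R) k j v :
  v \in pow_sub V m (k + j) -> v \in pow_sub V m j.
Proof.
elim: k v => // k IH v /span_min; apply => _ [a [u [_ hu ->]]].
by rewrite rpredZ // IH.
Qed.

(* H^0_m(V) for a module V over an R-algebra A with structure map phi: this is
   used with A = R and A = R[T_1, ..., T_r]. *)
Section H0.
Variables (A : comNzRingType) (phi : {rmorphism R -> A}).

Fact submodP_H0 (V : lmodType A) : submodP (fun v : V => exists k : nat,
  forall a : R, a \in (ideal_pow k : {pred R^o}) -> phi a *: v = 0).
Proof.
split=> [|c u v [k hk] [j hj]]; first by exists 0%N => a _; rewrite scaler0.
exists (k + j)%N => a ha; rewrite scalerDr scalerA mulrC -scalerA.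
have -> : phi a *: v = 0 by apply: hj; exact: (@pow_sub_anti _ k j).
have -> : phi a *: u = 0 by apply: hk; apply: (@pow_sub_anti _ j k); rewrite addnC.
by rewrite scaler0 addr0.
Qed.
Definition H0 (V : lmodType A) : submodClosed V := mksub (submodP_H0 V).
End H0.

Definition H0R (V : lmodType R) : lmodType R := subm (H0 idfun V).

Section GradedH0.
Variable r : nat.
Local Notation S := {mpoly R[r]}.
Definition H0S (V : lmodType S) : submodClosed V := H0 (@mpolyC r R) V.

Fact H0_grading (V : grmod R r) :
  is_grading (V := subm (H0S V)) (fun n v => gm_deg n (val v)).
Proof.
have [d0 dB dZ dd du] := gm_grading V; split.
- by move=> n; rewrite raddf0.
- by move=> n u v hu hv; rewrite raddfB; apply: dB.
- by move=> k n p v hp hv; rewrite linearZ; apply: dZ.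
- move=> [v hv]; have [b [c [hc e]]] := dd v.
  have hcH n : (n < b)%N -> c n \in H0S V.
    move=> nb; have /mksubP[k hk] := hv; apply/mksubP; exists k => a ha.
    have hC : a%:MP_[r] \is 0.-homog by rewrite -[a]mulr1 mpolyCM mul_mpolyC mpolyC1 rpredZ ?dhomog1.
    apply: (du b (fun n => a%:MP_[r] *: c n)) nb.
      by move=> j; rewrite -[j]add0n; apply: dZ (hc j); apply: hC.
    by rewrite -scaler_sumr -e; exact: hk.
  exists b, (fun n => insubd 0 (c n)); split=> [n|].
    by rewrite val_insubd; case: ifP => _; [exact: hc | exact: d0].
  apply: val_inj; rewrite raddf_sum /= e; apply: eq_bigr => n _.
  by rewrite val_insubd hcH.
- move=> b c hc e n nb; apply: val_inj; rewrite raddf0.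
  apply: (du b (fun n => val (c n))) nb => //.
  by rewrite -raddf_sum e raddf0.
Qed.
Definition H0_gr (V : grmod R r) : grmod R r := GrMod (H0_grading V).

Section Map.
Variables (V W : grmod R r) (f : ghom V W).

Fact H0_map_mem (v : subm (H0S V)) : f (val v) \in H0S W.
Proof.
have /mksubP[k hk] := valP v; apply/mksubP; exists k => a /hk e.
by rewrite -linearZ e linear0.
Qed.
Definition H0_map_fun (v : H0_gr V) : H0_gr W := exist _ (f (val v)) (H0_map_mem v).
Fact H0_map_linear : linear H0_map_fun.
Proof. by move=> p u v; apply: val_inj; rewrite /= linearP. Qed.
HB.instance Definition _ :=
  GRing.isLinear.Build S (H0_gr V) (H0_gr W) *:%R H0_map_fun H0_map_linear.
Fact H0_map_deg n (v : H0_gr V) : gm_deg n v -> gm_deg n (H0_map_fun v).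
Proof. exact: (@gh_deg _ _ _ _ f). Qed.
Definition H0_map : ghom (H0_gr V) (H0_gr W) := GHom H0_map_deg.
End Map.

Fact H0_complex_dd (C : nat -> grmod R r) (K : gcomplex C) j v :
  H0_map (K j) (H0_map (K j.+1) v) = 0.
Proof. by apply: val_inj; rewrite /= gc_dd. Qed.
Definition H0_complex (C : nat -> grmod R r) (K : gcomplex C) :
    gcomplex (fun j => H0_gr (C j)) :=
  @GComplex R r (fun j => H0_gr (C j)) (fun j => H0_map (K j)) (@H0_complex_dd C K).

Definition H0_incl_fun (V : grmod R r) (v : H0_gr V) : V := val v.
Fact H0_incl_linear V : linear (@H0_incl_fun V).
Proof. by move=> p u v; rewrite /H0_incl_fun linearP. Qed.
HB.instance Definition _ V :=
  GRing.isLinear.Build S (H0_gr V) V *:%R (@H0_incl_fun V) (@H0_incl_linear V).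
Fact H0_incl_deg V n (v : H0_gr V) : gm_deg n v -> gm_deg n (H0_incl_fun v).
Proof. by []. Qed.
Definition H0_incl (V : grmod R r) : ghom (H0_gr V) V := GHom (@H0_incl_deg V).

Definition gid_fun (V : grmod R r) (v : V) : V := v.
Fact gid_linear V : linear (@gid_fun V). Proof. by []. Qed.
HB.instance Definition _ (V : grmod R r) :=
  GRing.isLinear.Build S V V *:%R (@gid_fun V) (@gid_linear V).
Fact gid_deg (V : grmod R r) n (v : V) : gm_deg n v -> gm_deg n (@gid_fun V v). Proof. by []. Qed.
Definition gid (V : grmod R r) : ghom V V := GHom (@gid_deg V).

Variables (x : 'I_r -> R) (M : lmodType R).

Definition tens_H0_incl (s : nat) (N : lmodType R) : ghom (tens r s (H0R N)) (tens r s N) :=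
  tens_map r s (val : {linear H0R N -> N}).

(* The terms of
   0 -> H0(H_r) (x) S[-r] -> ... -> H0(H_0) (x) S -> H0(gr) -> 0
   and their canonical maps to the approximation complex. *)
Definition lc_term (j : nat) : grmod R r :=
  if j is i.+1 then tens r i (H0R (khom x M i)) else H0_gr (gr x M).

Definition lc_incl (j : nat) : ghom (lc_term j) (apx_term x M j) :=
  match j with
  | 0 => H0_incl (gr x M)
  | i.+1 => tens_H0_incl i (khom x M i)
  end.

(* The terms of
   0 -> H_r (x) S[-r] -> ... -> H_1 (x) S[-1] -> H0(H_0) (x) S -> H0(gr) -> 0
   and their canonical maps to the approximation complex. *)
Definition am_term (j : nat) : grmod R r :=
  match j with
  | 0 => H0_gr (gr x M)
  | 1 => tens r 0 (H0R (khom x M 0))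
  | i.+2 => tens r i.+1 (khom x M i.+1)
  end.

Definition am_incl (j : nat) : ghom (am_term j) (apx_term x M j) :=
  match j with
  | 0 => H0_incl (gr x M)
  | 1 => tens_H0_incl 0 (khom x M 0)
  | i.+2 => gid (tens r i.+1 (khom x M i.+1))
  end.
End GradedH0.
End LocalCohomology.

Section Hypotheses.
Variable R : comNzRingType.
Implicit Types (I J p m : idealT R) (V M : lmodType R).

Definition finite_module V : Prop :=
  exists s : seq V, forall v, v \in span (fun u => u \in s).

Definition noetherian : Prop :=
  forall I, exists s : seq R^o, (I : {pred R^o}) =i span (fun a => a \in s).

Definition is_proper I : Prop := (1 : R) \notin (I : {pred R^o}).

Definition sub_ideal I J : Prop := {subset (I : {pred R^o}) <= (J : {pred R^o})}.

Definition maximal_ideal I : Prop :=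
  is_proper I /\ forall J, is_proper J -> sub_ideal I J -> sub_ideal J I.

Definition local_ring m : Prop :=
  maximal_ideal m /\ forall J, maximal_ideal J -> (J : {pred R^o}) =i (m : {pred R^o}).

Definition prime_ideal p : Prop :=
  is_proper p /\ forall a b : R, a * b \in (p : {pred R^o}) ->
    a \in (p : {pred R^o}) \/ b \in (p : {pred R^o}).

Definition contains_ann V p : Prop :=
  forall a : R, (forall v : V, a *: v = 0) -> a \in (p : {pred R^o}).

(* A strict chain P 0 < ... < P n of primes of R / ann V. *)
Definition prime_chain V (n : nat) (P : nat -> idealT R) : Prop :=
  (forall i, (i <= n)%N -> prime_ideal (P i) /\ contains_ann V (P i)) /\
  (forall i, (i < n)%N -> sub_ideal (P i) (P i.+1) /\ ~ sub_ideal (P i.+1) (P i)).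

(* dim V = n, the Krull dimension of R / ann V. *)
Definition has_dim V (n : nat) : Prop :=
  (exists P, prime_chain V n P) /\
  (forall k P, prime_chain V k P -> (k <= n)%N).

(* The lengths of strict chains N 0 < ... < N n of submodules are bounded. *)
Definition finite_length V : Prop :=
  exists b : nat, forall (n : nat) (N : nat -> submodClosed V),
    (forall i, (i < n)%N -> {subset N i <= N i.+1} /\ ~ {subset N i.+1 <= N i}) ->
    (n <= b)%N.

Section Sequences.
Variables (r : nat) (x : 'I_r -> R) (M : lmodType R).

Definition partial_sop m : Prop :=
  (forall k, x k \in (m : {pred R^o})) /\
  exists e : nat, has_dim (quom (scale_sub (xideal x) (sub_full M))) e /\
    has_dim M (r + e).

(* (x_1, ..., x_{i-1}) M *)
Definition initial_sub (i : 'I_r) : submodClosed M :=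
  scale_sub (span (fun a : R^o => exists2 l : 'I_r, (l < i)%N & a = x l)) (sub_full M).

Definition d_sequence : Prop :=
  forall i j : 'I_r, (i <= j)%N -> forall v : M,
    ((x i * x j) *: v \in initial_sub i) = (x j *: v \in initial_sub i).

Definition amenable : Prop :=
  forall i : nat, (0 < i)%N -> finite_length (khom x M i).
End Sequences.
End Hypotheses.

(* Main.v *)
From HB Require Import structures.
Require Import Defs.
From mathcomp Require Import all_boot all_order all_algebra.
From mathcomp Require Import boolp.
From mathcomp Require Import mpoly.

Set Implicit Arguments.
Unset Strict Implicit.
Unset Printing Implicit Defensive.

Import GRing.Theory.
Local Open Scope ring_scope.

(** Let [I = (x_1, ..., x_r)].  Since an element of [N (x) S] has finitely many
coefficients in [N], one has [H^0_m(N (x) S) = H^0_m(N) (x) S], and the first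
complex is the restriction of the approximation complex to the submodules of
[m]-torsion elements ([complex_restrict], [H0S_tens]).

The second assertion rests on the acyclicity of the approximation complex of a
d-sequence ([approx_exact]).  Granted this, amenability makes the terms with
[i > 0] torsion modules: an equality [m^k v = m^(k+1) v] must occur in a module
of finite length, and Nakayama's lemma gives [m^k v = 0]
([finite_length_torsion]).  The restricted complex then
has the full terms in homological degrees [i > 0], so it inherits exactness
everywhere except for the surjectivity onto [H^0_m(gr)].  If [w] in [gr] is
killed by [m^k] and lifts to [v] in [H_0 (x) S], then [m^k v] lies in the image
of [H_1 (x) S], hence is torsion, and as [m^k] is finitely generated [v] is
torsion too ([H0_saturated], [am_aug_surj]).

For the acyclicity, represent elements of [H_i(x; M) (x) S] by cycles of the
Koszul complex of [x] with coefficients in the module [M[T]] of polynomials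
over [M].  This complex has two anticommuting differentials, [dx] and [dT],
given by [x] and by the variables.  The d-sequence property implies that [x] is
relatively regular, [((x_1, ..., x_(k-1))M : x_k) :&: IM = (x_1, ..., x_(k-1))M]
([dseq_rel_regular]), and so the same holds over [M[T]].  A cycle of positive
degree with coordinates in [I M[T]] is then a boundary, already in the Koszul
complex of an initial part of [x] ([kideal_cycle]).  For exactness in positive
degrees, let [z] be a [dx]-cycle with [dT z] a boundary.  One removes the last
exterior generator from [z] by subtracting elements [dT w + dx y] with
[dx w = 0], which is done by induction on the degree of its coefficient in the
last variable ([approx_cycle]).

In degree 0 exactness says that a form of degree [n] over [M] whose value at
[x] lies in [I^(n+1) M] is a combination of linear syzygies of [x], up to
coefficients in [IM].  This follows from the relation
[((x_1, ..., x_(k-1))M : x_k) :&: I^(n+1) M = (x_1, ..., x_(k-1)) I^n M] by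
eliminating the variables one after the other ([dseq_colon_pow],
[linear_type], [evalx_kernel]). *)

(** * Contraction, exterior multiplication and Koszul operators *)

Section KoszulOperators.
Variables (R : comNzRingType) (r : nat) (N : lmodType R).
Local Notation L := (koszul r N).
Implicit Types (f g : L) (J : {set 'I_r}) (k l : 'I_r).

Definition kext k f : L :=
  [ffun J : {set 'I_r} => if k \in J then ksign R k (J :\ k) *: f (J :\ k) else 0].

Fact kext_linear k : linear (kext k).
Proof.
move=> c f g; apply/ffunP => J; rewrite koszulDE koszulZE !ffunE.
case: ifP => _; last by rewrite scaler0 addr0.
by rewrite scalerDr !scalerA mulrC.
Qed.
HB.instance Definition _ k :=
  GRing.isLinear.Build R L L *:%R (kext k) (kext_linear k).

Lemma contr0P k f : contr k f = 0 -> forall J, k \in J -> f J = 0.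
Proof.
move=> e J kJ; have /(congr1 (fun g : L => g (J :\ k))) := e.
rewrite koszul0E ffunE setD11 setD1K // => /(congr1 ( *:%R (ksign R k (J :\ k)))).
by rewrite scaler0 scalerA -expr2 sqrr_sign scale1r.
Qed.

Lemma contr_self k f : contr k (contr k f) = 0.
Proof. by apply/ffunP => J; rewrite !ffunE setU11 scaler0 if_same. Qed.

Lemma kext_self k f : kext k (kext k f) = 0.
Proof. by apply/ffunP => J; rewrite !ffunE setD11 scaler0 if_same. Qed.

Lemma contr_kext k f : contr k (kext k f) + kext k (contr k f) = f.
Proof.
apply/ffunP => J; rewrite koszulDE !ffunE setU11 setD11.
case: ifPn => kJ; last by rewrite setU1K // addr0 scalerA -expr2 sqrr_sign scale1r.
by rewrite setD1K // add0r scalerA -expr2 sqrr_sign scale1r.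
Qed.

Lemma kext_notin k f J : k \notin J -> kext k f J = 0.
Proof. by move=> kJ; rewrite ffunE (negPf kJ). Qed.

(** The anticommutator [h] of the two operators takes values supported on the
sets that contain [k], so [h f] vanishes as soon as [contr k] kills it.  The
anticommutation of contractions gives [contr k (h f) = h (contr k f)], hence
[h f = 0] first when [contr k f = 0] and then for every [f].  This avoids
comparing signs. *)
Lemma contr_kextC k l f : l != k -> contr l (kext k f) = - kext k (contr l f).
Proof.
move=> lk; pose h g := contr l (kext k g) + kext k (contr l g).
suff h0 g : h g = 0 by apply/eqP; rewrite -addr_eq0; apply/eqP/h0.
have hk g' : contr k (h g') = h (contr k g').
  have cK u : contr k (kext k u) = u - kext k (contr k u).
    by rewrite -[X in X - _](contr_kext k u) addrK.
  rewrite /h linearD /= contr_contr !cK linearB /= (contr_contr k l) linearN /=.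
  by rewrite opprB opprK addrA subrK.
have h_out g' J : k \notin J -> h g' J = 0.
  move=> kJ; rewrite /h koszulDE [X in _ + X]kext_notin // addr0 ffunE.
  case: ifP => // _; rewrite kext_notin ?scaler0 //.
  by rewrite !inE negb_or kJ eq_sym lk.
have hc0 g' : contr k g' = 0 -> h g' = 0.
  move=> e; apply/ffunP => J; rewrite koszul0E.
  have [kJ|kJ] := boolP (k \in J); last exact: h_out.
  apply: (contr0P (k := k)) kJ; rewrite hk e /h.
  by rewrite !linear0 addr0.
apply/ffunP => J; rewrite koszul0E.
have [kJ|kJ] := boolP (k \in J); last exact: h_out.
by apply: (contr0P (k := k)) kJ; rewrite hk; apply: hc0; apply: contr_self.
Qed.

Lemma kext_supp k i f : f \in ksupp r N i -> kext k f \in ksupp r N i.+1.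
Proof.
move=> /mksubP hf; apply/mksubP => J hJ; rewrite ffunE; case: ifP => // kJ.
by rewrite hf ?scaler0 //; move: hJ; rewrite (cardsD1 k) kJ.
Qed.

Definition kmap (g : {linear N -> N}) f : L := [ffun J : {set 'I_r} => g (f J)].
Fact kmap_linear (g : {linear N -> N}) : linear (kmap g).
Proof.
by move=> c f f0; apply/ffunP => J; rewrite !ffunE linearP.
Qed.
HB.instance Definition _ (g : {linear N -> N}) := GRing.isLinear.Build R L L *:%R (kmap g) (kmap_linear g).

Lemma kmap_contr (g : {linear N -> N}) k f : kmap g (contr k f) = contr k (kmap g f).
Proof. by apply/ffunP => J; rewrite !ffunE; case: ifP; rewrite ?linear0 // linearZ. Qed.

Lemma kmap_kext (g : {linear N -> N}) k f : kmap g (kext k f) = kext k (kmap g f).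
Proof. by apply/ffunP => J; rewrite !ffunE; case: ifP; rewrite ?linear0 // linearZ. Qed.

Lemma kmap_supp (g : {linear N -> N}) i f : f \in ksupp r N i -> kmap g f \in ksupp r N i.
Proof.
by move=> /mksubP hf; apply/mksubP => J hJ; rewrite ffunE hf ?linear0.
Qed.

(** The Koszul differential of a family of endomorphisms of [N]; the two
differentials of the approximation complex are the cases of the multiplications
by the [x_k] and by the variables [T_k]. *)
Definition kop (s : 'I_r -> {linear N -> N}) f : L := \sum_k kmap (s k) (contr k f).
Fact kop_linear s : linear (kop s).
Proof.
move=> c f g; rewrite /kop scaler_sumr -big_split; apply: eq_bigr => k _ /=.
by rewrite !linearP.
Qed.
HB.instance Definition _ s := GRing.isLinear.Build R L L *:%R (kop s) (kop_linear s).

Lemma kopE s f J : kop s f J = \sum_k s k (contr k f J).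
Proof. by rewrite koszul_sumE; apply: eq_bigr => k _; rewrite ffunE. Qed.

Lemma kop_contr s k f : kop s (contr k f) = - contr k (kop s f).
Proof.
rewrite /kop linear_sum -sumrN; apply: eq_bigr => l _ /=.
by rewrite contr_contr linearN /= kmap_contr.
Qed.

Lemma kop_kext s k f : kop s (kext k f) = kmap (s k) f - kext k (kop s f).
Proof.
have e : kmap (s k) f = kmap (s k) (contr k (kext k f)) + kext k (kmap (s k) (contr k f)).
  by rewrite -kmap_kext -linearD /= contr_kext.
rewrite /kop (bigD1 k) //= [in RHS](bigD1 k) //= linearD opprD addrA e addrK.
congr (_ + _); rewrite linear_sum -sumrN; apply: eq_bigr => l lk /=.
by rewrite contr_kextC // linearN /= kmap_kext.
Qed.

Lemma kop_comm (s t : 'I_r -> {linear N -> N}) f :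
  (forall k l v, s k (t l v) = t l (s k v)) ->
  kop s (kop t f) = - kop t (kop s f).
Proof.
move=> st; apply/ffunP => J; rewrite koszulNE !kopE.
have e (s' t' : 'I_r -> {linear N -> N}) : \sum_k s' k (contr k (kop t' f) J) =
   \sum_k \sum_l s' k (t' l (contr k (contr l f) J)).
  apply: eq_bigr => k _; rewrite -linear_sum; congr (s' k _).
  rewrite /kop linear_sum koszul_sumE; apply: eq_bigr => l _.
  by rewrite /= -kmap_contr ffunE.
rewrite !e exchange_big -sumrN; apply: eq_bigr => l _.
rewrite -sumrN; apply: eq_bigr => k _.
by rewrite contr_contr koszulNE !linearN st.
Qed.

Lemma kop_kop (s : 'I_r -> {linear N -> N}) f :
  (forall k l v, s k (s l v) = s l (s k v)) -> kop s (kop s f) = 0.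
Proof.
move=> ss; transitivity (\sum_(k < r) \sum_(l < r)
    kmap (s k) (kmap (s l) (contr k (contr l f)))).
  apply: eq_bigr => k _; rewrite /kop !linear_sum; apply: eq_bigr => l _ /=.
  by rewrite -kmap_contr.
apply: antisym_sum0 => [k|k l]; first by rewrite contr_self !linear0.
rewrite contr_contr !linearN /=; congr (- _).
by apply/ffunP => J; rewrite !ffunE ss.
Qed.

Lemma kop_supp s i f : f \in ksupp r N i.+1 -> kop s f \in ksupp r N i.
Proof. by move=> hf; apply: rpred_sum => k _; apply/kmap_supp/contr_supp. Qed.

Definition kconst (v : N) : L := [ffun J : {set 'I_r} => if J == set0 then v else 0].
Fact kconst_linear : linear kconst.
Proof.
move=> c u v; apply/ffunP => J; rewrite koszulDE koszulZE !ffunE.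
by case: ifP => _ //; rewrite scaler0 addr0.
Qed.
HB.instance Definition _ := GRing.isLinear.Build R N L *:%R kconst kconst_linear.

Lemma kconst_supp v : kconst v \in ksupp r N 0.
Proof. by apply/mksubP => J; rewrite cards_eq0 ffunE => /negPf ->. Qed.

Lemma contr_kconst k v : contr k (kconst v) = 0.
Proof.
apply/ffunP => J; rewrite koszul0E !ffunE; case: ifP => // _.
have -> : (k |: J == set0) = false by apply/negbTE/set0Pn; exists k; rewrite setU11.
by rewrite scaler0.
Qed.

Lemma kmap_kconst (g : {linear N -> N}) v : kmap g (kconst v) = kconst (g v).
Proof. by apply/ffunP => J; rewrite !ffunE; case: ifP; rewrite ?linear0. Qed.

Lemma supp0_kconst f : f \in ksupp r N 0 -> f = kconst (f set0).
Proof.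
move=> /mksubP hf; apply/ffunP => J; rewrite ffunE.
by case: eqP => [->//|/eqP h]; rewrite hf // cards_eq0.
Qed.

Lemma kop_kconst s v : kop s (kconst v) = 0.
Proof. by rewrite /kop big1 // => k _; rewrite contr_kconst linear0. Qed.

Lemma supp_set0 i f : f \in ksupp r N i.+1 -> f set0 = 0.
Proof. by move=> /mksubP; apply; rewrite cards0. Qed.

Lemma kop_kext_kconst s k v : kop s (kext k (kconst v)) = kconst (s k v).
Proof.
by rewrite kop_kext kop_kconst linear0 subr0 kmap_kconst.
Qed.
End KoszulOperators.

Section InitialKoszul.
Variables (R : comNzRingType) (r : nat) (N : lmodType R).
Local Notation L := (koszul r N).
Implicit Types (f g : L).

(** The elements that involve only the first [k] exterior generators, described
by contractions so that membership follows from anticommutation rules. *)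
Definition kinit_prop (k : nat) f := forall l : 'I_r, (k <= l)%N -> contr l f = 0.
Fact submodP_kinit k : submodP (kinit_prop k).
Proof.
split=> [l _|c f g hf hg l kl]; first exact: linear0.
by rewrite linearP /= hf // hg // scaler0 addr0.
Qed.
Definition kinit k : submodClosed L := mksub (submodP_kinit k).

Lemma kinitP k f : reflect (kinit_prop k f) (f \in kinit k).
Proof. exact: mksubP. Qed.

Lemma kinit_le k k' f : (k <= k')%N -> f \in kinit k -> f \in kinit k'.
Proof. by move=> kk /kinitP hf; apply/kinitP => l /(leq_trans kk); apply: hf. Qed.

Lemma kinit_geq k f : (r <= k)%N -> f \in kinit k.
Proof. by move=> rk; apply/kinitP => l /(leq_trans rk); rewrite leqNgt ltn_ord. Qed.

Lemma kinit0 f : f \in kinit 0 -> f = kconst r (f set0).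
Proof.
move=> /kinitP hf; apply/ffunP => J; rewrite ffunE; case: eqP => [->//|/eqP].
by case/set0Pn => l; apply: contr0P; apply: hf.
Qed.

Lemma kinit_kop s k f : f \in kinit k -> kop s f \in kinit k.
Proof.
move=> /kinitP hf; apply/kinitP => l kl; apply/eqP; rewrite -oppr_eq0.
by rewrite -kop_contr hf // linear0.
Qed.

Lemma kinit_kmap (g : {linear N -> N}) k f : f \in kinit k -> kmap g f \in kinit k.
Proof. by move=> /kinitP hf; apply/kinitP => l kl; rewrite -kmap_contr hf // linear0. Qed.

Lemma kinit_kconst k v : kconst r v \in kinit k.
Proof. by apply/kinitP => l _; apply: contr_kconst. Qed.

Lemma kinit_kext k (l : 'I_r) f : (l < k)%N -> f \in kinit k -> kext l f \in kinit k.
Proof.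
move=> lk /kinitP hf; apply/kinitP => j kj; rewrite contr_kextC ?hf ?linear0 ?oppr0 //.
by rewrite -val_eqE; apply: contraTneq kj => /= ->; rewrite -ltnNge.
Qed.

Variables (k : 'I_r) (f : L).

Lemma contr_kext_kinit : f \in kinit k -> contr k (kext k f) = f.
Proof.
by move=> /kinitP hf; rewrite -[RHS](contr_kext k f) (hf k) // linear0 addr0.
Qed.

Hypothesis hf : f \in kinit k.+1.

Lemma kinit_top : contr k f \in kinit k.
Proof.
apply/kinitP => l; rewrite leq_eqVlt => /orP[/eqP/val_inj <-|kl]; first exact: contr_self.
by move/kinitP: hf => hf'; rewrite contr_contr hf' // linear0 oppr0.
Qed.

Lemma kinit_bot : contr k (kext k f) \in kinit k.
Proof.
apply/kinitP => l; rewrite leq_eqVlt => /orP[/eqP/val_inj <-|kl]; first exact: contr_self.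
move/kinitP: hf => hf'; rewrite contr_contr contr_kextC.
  by rewrite hf' // !(linear0, oppr0).
by rewrite -val_eqE /= neq_ltn kl orbT.
Qed.
End InitialKoszul.
(** * Relatively regular sequences *)

Lemma sum_ltS (V : zmodType) r (k : 'I_r) (E : 'I_r -> V) :
  \sum_(l < r | (l < k.+1)%N) E l = \sum_(l < r | (l < k)%N) E l + E k.
Proof.
rewrite (bigD1 k) //= addrC; congr (_ + _); apply: eq_bigl => l.
by rewrite ltnS [(l < k)%N]ltn_neqAle andbC.
Qed.

Section LinearCombinations.
Variables (R : comNzRingType) (r : nat) (x : 'I_r -> R) (V : lmodType R).
Variable Q : submodClosed V.

Fact submodP_lincomb (k : nat) : submodP (fun v : V => exists u : 'I_r -> V,
  (forall l, u l \in Q) /\ v = \sum_(l < r | (l < k)%N) x l *: u l).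
Proof.
split=> [|c _ _ [u [hu ->]] [v [hv ->]]].
  exists (fun=> 0); split=> [l|]; first exact: rpred0.
  by rewrite big1 // => l _; rewrite scaler0.
exists (fun l => c *: u l + v l); split=> [l|]; first by rewrite rpredD ?rpredZ.
rewrite scaler_sumr -big_split; apply: eq_bigr => l _ /=.
by rewrite scalerDr !scalerA mulrC.
Qed.

(** The submodule [(x_1, ..., x_k) Q].  The bound [k] is a natural number, not
an index of the sequence, so that [k = r] gives the whole ideal. *)
Definition lincomb k : submodClosed V := mksub (submodP_lincomb k).

Lemma lincomb_in k (l : 'I_r) v : (l < k)%N -> v \in Q -> x l *: v \in lincomb k.
Proof.
move=> lk hv; apply/mksubP; exists (fun j => if j == l then v else 0); split.
  by move=> j; case: ifP => // _; apply: rpred0.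
rewrite (bigD1 l) //= eqxx big1 ?addr0 // => j /andP[_ /negPf ->].
exact: scaler0.
Qed.

Lemma lincomb_min k (P : submodClosed V) v :
  (forall (l : 'I_r) u, (l < k)%N -> u \in Q -> x l *: u \in P) -> v \in lincomb k -> v \in P.
Proof. by move=> h /mksubP[u [hu ->]]; apply: rpred_sum => l lk; apply: h. Qed.

Lemma lincomb_le k k' v : (k <= k')%N -> v \in lincomb k -> v \in lincomb k'.
Proof.
move=> kk; apply: lincomb_min => l u lk; apply: lincomb_in; exact: leq_trans kk.
Qed.

Lemma lincomb0 v : v \in lincomb 0 -> v = 0.
Proof. by move=> /mksubP[u [_ ->]]; rewrite big_pred0. Qed.

Lemma lincombS (k : 'I_r) v : v \in lincomb k.+1 ->
  exists w u, [/\ w \in lincomb k, u \in Q & v = w + x k *: u].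
Proof.
move=> /mksubP[u [hu ->]]; exists (\sum_(l < r | (l < k)%N) x l *: u l), (u k).
by split=> //; [apply/mksubP; exists u | apply: sum_ltS].
Qed.
End LinearCombinations.

Lemma lincomb_map (R : comNzRingType) r (x : 'I_r -> R) (V W : lmodType R)
    (g : {linear V -> W}) (Q : submodClosed V) (P : submodClosed W) k v :
  (forall u, u \in Q -> g u \in P) -> v \in lincomb x Q k -> g v \in lincomb x P k.
Proof.
move=> h /mksubP[u [hu ->]]; apply/mksubP; exists (fun l => g (u l)); split.
  by move=> l; apply: h.
by rewrite linear_sum; apply: eq_bigr => l _; rewrite linearZ.
Qed.

Definition init_sub (R : comNzRingType) r (x : 'I_r -> R) (V : lmodType R) k :=
  lincomb x (sub_full V) k.

(** The relation [((x_1, ..., x_(k-1))V : x_k) :&: (x)V = (x_1, ..., x_(k-1))V]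
satisfied by d-sequences.  In this form the property passes from [M] to the
module of polynomials over [M], and it can be applied to the coordinates of
Koszul cycles. *)
Definition rel_regular (R : comNzRingType) r (x : 'I_r -> R) (V : lmodType R) : Prop :=
  forall (k : 'I_r) (v : V), x k *: v \in init_sub x V k ->
    v \in init_sub x V r -> v \in init_sub x V k.

Lemma mem_sub_full (R : comNzRingType) (V : lmodType R) (v : V) : v \in sub_full V.
Proof. exact/mksubP. Qed.

(** * Koszul cycles of a relatively regular sequence *)

Section KoszulCycles.
Variables (R : comNzRingType) (r : nat) (x : 'I_r -> R) (N : lmodType R).
Local Notation L := (koszul r N).
Implicit Types (f g z : L).

Definition xmul (k : 'I_r) : {linear N -> N} := @scalem R N (x k).
Local Notation dx := (kop xmul).

Lemma kmap_xmul k f : kmap (xmul k) f = x k *: f.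
Proof. by apply/ffunP => J; rewrite [LHS]ffunE [RHS]koszulZE. Qed.

Lemma xmulC k l v : xmul k (xmul l v) = xmul l (xmul k v).
Proof. by rewrite /= /scalem !scalerA mulrC. Qed.

Lemma xmul_comm (g : {linear N -> N}) k v : g (xmul k v) = xmul k (g v).
Proof. by rewrite /= /scalem linearZ. Qed.

Lemma dxdx f : dx (dx f) = 0.
Proof. by apply: kop_kop; apply: xmulC. Qed.

Lemma dx_kext k f : dx (kext k f) = x k *: f - kext k (dx f).
Proof. by rewrite kop_kext kmap_xmul. Qed.

Lemma dx_kmap (g : {linear N -> N}) f : dx (kmap g f) = kmap g (dx f).
Proof.
rewrite /kop linear_sum; apply: eq_bigr => k _; rewrite -kmap_contr.
by apply/ffunP => J; rewrite !ffunE xmul_comm.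
Qed.

Fact submodP_kideal : submodP (fun f => forall J, f J \in init_sub x N r).
Proof.
split=> [J|c f g hf hg J]; first by rewrite koszul0E rpred0.
by rewrite koszulDE koszulZE rpredD ?rpredZ.
Qed.
Definition kideal : submodClosed L := mksub submodP_kideal.

Lemma kideal_contr k f : f \in kideal -> contr k f \in kideal.
Proof.
move=> /mksubP hf; apply/mksubP => J; rewrite ffunE.
by case: ifP => _; rewrite ?rpred0 ?rpredZ.
Qed.

Lemma kideal_kext k f : f \in kideal -> kext k f \in kideal.
Proof.
move=> /mksubP hf; apply/mksubP => J; rewrite ffunE.
by case: ifP => _; rewrite ?rpred0 ?rpredZ.
Qed.

Lemma kideal_kmap (g : {linear N -> N}) f : f \in kideal -> kmap g f \in kideal.
Proof.
move=> /mksubP hf; apply/mksubP => J; rewrite ffunE.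
by apply: lincomb_map (hf J) => u _; apply: mem_sub_full.
Qed.

Lemma kidealZ k f : x k *: f \in kideal.
Proof. by apply/mksubP => J; rewrite koszulZE lincomb_in ?mem_sub_full. Qed.

Lemma kideal_dx f : dx f \in kideal.
Proof. by apply: rpred_sum => k _; rewrite kmap_xmul kidealZ. Qed.

Lemma dx_set0 k f : f \in kinit r N k -> dx f set0 \in init_sub x N k.
Proof.
move=> /kinitP hf; rewrite kopE; apply: rpred_sum => l _ /=.
have [lk|kl] := ltnP l k; first by rewrite lincomb_in ?mem_sub_full.
by rewrite hf // koszul0E linear0 rpred0.
Qed.

Lemma init_sub_dx k v : v \in init_sub x N k ->
  exists y, [/\ y \in kinit r N k, y \in ksupp r N 1 & kconst r v = dx y].
Proof.
move=> /mksubP[u [_ ->]].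
exists (\sum_(l < r | (l < k)%N) kext l (kconst r (u l))); split.
- by apply: rpred_sum => l lk; apply/kinit_kext/kinit_kconst.
- by apply: rpred_sum => l _; apply/kext_supp/kconst_supp.
by rewrite !linear_sum; apply: eq_bigr => l _; rewrite /= kop_kext_kconst.
Qed.

Hypothesis x_reg : rel_regular x N.

(** Induction on the number of variables.  Let [e] be the last of [k+1]
exterior generators, [y] the corresponding element of the sequence, and write
the cycle as [z = z0 + e z1].  Then [z1] is a cycle with coordinates in [(x)N]
and [y z1 = - dx z0], so that relative regularity puts its coordinate of degree
0 in [(x_1, ..., x_k)N].  Hence [z1 = dx y1], and adding [dx (e y1)] to [z]
leaves [z0 + y y1], which does not involve [e] and still has its coordinates in
[(x)N]. *)
Lemma kideal_cycle k i z : (k <= r)%N -> z \in kinit r N k -> z \in ksupp r N i ->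
    dx z = 0 -> z \in kideal -> z set0 \in init_sub x N k ->
  exists y, [/\ y \in kinit r N k, y \in ksupp r N i.+1 & z = dx y].
Proof.
elim: k i z => [|k IH] i z kr hz zi dz zI z0.
  exists 0; rewrite !rpred0 linear0; split=> //.
  by rewrite (kinit0 hz) (lincomb0 z0) linear0.
case: i zi => [|i] zi.
  by have [y [? ? e]] := init_sub_dx z0; exists y; rewrite -e -supp0_kconst.
pose kk := Ordinal kr; pose z1 := contr kk z; pose zb := contr kk (kext kk z).
have ez : z = zb + kext kk z1 by rewrite contr_kext.
have hz1 : z1 \in kinit r N k by apply: (@kinit_top _ _ _ kk).
have hzb : zb \in kinit r N k by apply: (@kinit_bot _ _ _ kk).
have dz1 : dx z1 = 0 by rewrite kop_contr dz linear0 oppr0.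
have dzb : dx zb + x kk *: z1 = 0.
  by rewrite -[RHS]dz [in RHS]ez linearD /= dx_kext dz1 linear0 subr0.
have zbI : zb \in kideal by apply/kideal_contr/kideal_kext.
have z1I : z1 \in kideal by apply: kideal_contr.
have [||y1 [hy1 y1i ey1]] := IH i z1 (ltnW kr) hz1 _ dz1 z1I.
- exact: contr_supp.
- apply: (x_reg (k := kk)); last by move/mksubP: z1I; apply.
  have -> : x kk *: z1 set0 = - dx zb set0.
    by apply/eqP; rewrite -addr_eq0 addrC -koszulZE -koszulDE dzb koszul0E.
  by rewrite rpredN dx_set0.
have eb : zb + x kk *: y1 = z + dx (kext kk y1).
  by rewrite dx_kext -ey1 ez addrACA subrr addr0.
have [|||||y0 [hy0 y0i ey0]] := IH i.+1 (zb + x kk *: y1) (ltnW kr).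
- by rewrite rpredD ?rpredZ.
- by rewrite rpredD ?rpredZ //; apply/contr_supp/kext_supp.
- by rewrite eb linearD /= dz dxdx addr0.
- by rewrite rpredD ?kidealZ.
- rewrite koszulDE koszulZE (supp_set0 y1i) scaler0 addr0.
  by rewrite (@supp_set0 _ _ _ i) ?rpred0 //; apply/contr_supp/kext_supp.
exists (y0 - kext kk y1); split.
- by apply: submodB; [|apply: kinit_kext => //]; apply: kinit_le (leqnSn k) _.
- by rewrite submodB // kext_supp.
by rewrite linearB /= -ey0 eb addrK.
Qed.

(** The coordinates of [x_l z] lie in [(x)N], so the preceding lemma applies:
the homology of positive degree of [K(x_1, ..., x_k; N)] is killed by every
[x_l]. *)
Lemma xmul_cycle k i (l : 'I_r) z : (k <= r)%N -> z \in kinit r N k ->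
    z \in ksupp r N i -> dx z = 0 -> z set0 = 0 ->
  exists y, [/\ y \in kinit r N k, y \in ksupp r N i.+1 & x l *: z = dx y].
Proof.
move=> kr hz zi dz z0; apply: kideal_cycle (kr) _ _ _ (kidealZ l z) _.
- exact: rpredZ.
- exact: rpredZ.
- by rewrite linearZ /= dz scaler0.
by rewrite koszulZE z0 scaler0 rpred0.
Qed.

(* [T] stands for the variables acting on polynomials and [D k] for the operator
   that divides by [T_k] the monomials divisible by [T_k] and kills the others. *)
Variables T D : 'I_r -> {linear N -> N}.
Hypothesis TC : forall k l v, T k (T l v) = T l (T k v).
Hypothesis DT : forall k v, D k (T k v) = v.
Hypothesis DTC : forall k l v, l != k -> D k (T l v) = T l (D k v).
Hypothesis D_nil : forall k v, exists p, iter p (D k) v = 0.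
Local Notation dT := (kop T).

Fact iter_lin (g : {linear N -> N}) p : linear (iter p g).
Proof. by elim: p => [|p IH] c u v //=; rewrite IH linearP. Qed.
HB.instance Definition _ (g : {linear N -> N}) p :=
  GRing.isLinear.Build R N N *:%R (iter p g) (iter_lin g p).

Lemma dTdT f : dT (dT f) = 0. Proof. exact: kop_kop. Qed.

Lemma dxdT f : dx (dT f) = - dT (dx f).
Proof. by apply: kop_comm => k l v; rewrite xmul_comm. Qed.

Lemma dT_iterD (k : 'I_r) p f : f \in kinit r N k ->
  kmap (iter p (D k)) (dT f) = dT (kmap (iter p (D k)) f).
Proof.
move=> /kinitP hf; rewrite /kop linear_sum; apply: eq_bigr => l _ /=.
have [lk|kl] := ltnP l k; last by rewrite hf // -kmap_contr hf // !linear0.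
rewrite -kmap_contr; apply/ffunP => J; rewrite !ffunE; case: ifP => _.
  by rewrite !linear0.
set v := _ *: _; elim: p => //= p ->; rewrite DTC //.
by rewrite -val_eqE /= neq_ltn lk.
Qed.

Lemma dT_iterT k p f : dT (kmap (iter p (T k)) f) = kmap (iter p (T k)) (dT f).
Proof.
rewrite /kop linear_sum; apply: eq_bigr => l _ /=; rewrite -kmap_contr.
apply/ffunP => J; rewrite !ffunE.
by set v := (if _ then _ else _); elim: p => //= p <-; rewrite TC.
Qed.

Lemma iterDT k p q v : iter (q + p) (D k) (iter p (T k) v) = iter q (D k) v.
Proof. by elim: p v => [|p IH] v; rewrite ?addn0 // addnS iterSr /= DT IH. Qed.

Lemma kmap_D_nil k f : exists p, kmap (iter p (D k)) f = 0.
Proof.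
have h J : exists p, iter p (D k) (f J) = 0 by apply: D_nil.
have [p hp] := choice h; exists (\max_J p J); apply/ffunP => J; rewrite koszul0E ffunE.
by rewrite -(subnK (leq_bigmax J)) /= iterD hp linear0.
Qed.

(** Induction on the number of variables.  Let [e], [y], [t] be the last of
[k+1] exterior generators, elements of the sequence and variables, and [D] the
division by [t].  Write [z = z0 + e z1]; the point is to lower the degree of
[z1] in [t] until [z1] vanishes.  If [D^(p+1)] kills [z1], then [g = D^p z1] is
the coefficient of [t^p].  Applying [D^(p+1)] to the part [dT z0 + t z1] of
[dT z] that does not involve [e] shows that [g + dT u] has its coordinates in
[(x)N], where [u = D^(p+1) z0] is a cycle because [dx z0 = - y z1].  Both
[g + dT u] and [y u] are then boundaries, [dx v] and [dx q] say, and
[w = e u - q] is a cycle.  The coefficient of [e] in [dT w - dx (e v)] is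
[- dT u + dx v = g], so that subtracting [t^p (dT w - dx (e v))] from [z]
removes the leading coefficient of [z1]. *)
Lemma approx_cycle k i z : (k <= r)%N -> z \in kinit r N k -> z \in ksupp r N i.+1 ->
    dx z = 0 -> dT z \in kideal ->
  exists w y, [/\ w \in ksupp r N i.+2, y \in ksupp r N i.+2, dx w = 0
    & z = dT w + dx y].
Proof.
elim: k z => [|k IHk] z kr hz zi dz dTz.
  exists 0, 0; rewrite !rpred0 !linear0; split=> //.
  by rewrite (kinit0 hz) (supp_set0 zi) linear0 addr0.
pose kk := Ordinal kr; have [p] := kmap_D_nil kk (contr kk z).
have le_k := kinit_le (leqnSn k).
elim: p z hz zi dz dTz => [|p IHp] z hz zi dz dTz hp.
  apply: IHk => //; first exact: ltnW.
  apply/kinitP => l; rewrite leq_eqVlt => /orP[/eqP/esym e|kl].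
    have -> : l = kk by apply: val_inj.
    by rewrite -[RHS]hp; apply/ffunP => J; rewrite [RHS]ffunE.
  by move/kinitP: hz; apply.
pose z1 := contr kk z; pose zb := contr kk (kext kk z).
have ez : z = zb + kext kk z1 by rewrite contr_kext.
have hz1 : z1 \in kinit r N k by apply: (@kinit_top _ _ _ kk).
have hzb : zb \in kinit r N k by apply: (@kinit_bot _ _ _ kk).
have z1i : z1 \in ksupp r N i by apply: contr_supp.
have zbi : zb \in ksupp r N i.+1 by apply/contr_supp/kext_supp.
have dz1 : dx z1 = 0 by rewrite kop_contr dz linear0 oppr0.
have dzb : dx zb = - (x kk *: z1).
  apply/eqP; rewrite -addr_eq0 -[X in _ == X]dz [in X in _ == X]ez linearD /= dx_kext.
  by rewrite dz1 linear0 subr0.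
pose Dp q := kmap (iter q (D kk)) : L -> L.
pose g := Dp p z1; pose u := Dp p.+1 zb.
have gi : g \in ksupp r N i by apply: kmap_supp.
have ui : u \in ksupp r N i.+1 by apply: kmap_supp.
have hg : g \in kinit r N k by apply: kinit_kmap.
have hu : u \in kinit r N k by apply: kinit_kmap.
have dg : dx g = 0 by rewrite dx_kmap dz1 linear0.
have du : dx u = 0 by rewrite dx_kmap dzb linearN linearZ /= hp scaler0 oppr0.
have guI : g + dT u \in kideal.
  have -> : g + dT u = Dp p.+1 (contr kk (kext kk (dT z))).
    pose t := dT zb + kmap (T kk) z1.
    have ht : t \in kinit r N k by rewrite rpredD ?kinit_kop ?kinit_kmap.
    have -> : kext kk (dT z) = kext kk t.
      rewrite [in LHS]ez linearD /= kop_kext addrA linearB /=.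
      by rewrite kext_self subr0.
    rewrite contr_kext_kinit // /Dp linearD /= dT_iterD // addrC; congr (_ + _).
    by apply/ffunP => J; rewrite !ffunE [RHS]iterSr DT.
  by apply/kideal_kmap/kideal_contr/kideal_kext.
have [q [hq qi eq]] := xmul_cycle kk (ltnW kr) hu ui du (supp_set0 ui).
have [||||v [hv vi ev]] := @kideal_cycle k i (g + dT u) (ltnW kr) _ _ _ guI.
- by rewrite rpredD ?kinit_kop.
- by rewrite rpredD // kop_supp.
- by rewrite linearD /= dg dxdT du linear0 oppr0 addr0.
- (* [y g] is the boundary of [- D^p z0], and [y (dT u)] that of [- dT q]. *)
  apply: (x_reg (k := kk)); last by move/mksubP: guI; apply.
  rewrite koszulDE scalerDr rpredD //.
    have -> : x kk *: g set0 = - dx (Dp p zb) set0.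
      by rewrite dx_kmap dzb -koszulNE -linearN opprK linearZ /= koszulZE.
    by rewrite rpredN dx_set0 // kinit_kmap.
  have -> : x kk *: dT u set0 = - dx (dT q) set0.
    by rewrite dxdT -eq linearZ /= koszulNE opprK koszulZE.
  by rewrite rpredN dx_set0 // kinit_kop.
pose w := kext kk u - q.
have wi : w \in ksupp r N i.+2 by rewrite submodB // kext_supp.
have hw : w \in kinit r N k.+1 by rewrite submodB ?kinit_kext ?le_k.
have dw : dx w = 0 by rewrite linearB /= dx_kext du linear0 subr0 eq subrr.
pose Tp := kmap (iter p (T kk)) : L -> L.
have [|||||w' [y [w'i yi dw' ey]]] := IHp (z - Tp (dT w - dx (kext kk v))).
- by rewrite submodB // kinit_kmap // submodB ?kinit_kop // kinit_kext ?le_k.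
- by rewrite submodB // kmap_supp // submodB ?kop_supp // kext_supp.
- by rewrite linearB /= dz dx_kmap linearB /= dxdx dxdT dw !(linear0, oppr0, subr0).
- rewrite linearB /= submodB // dT_iterT kideal_kmap // linearB /= dTdT sub0r rpredN.
  by rewrite -[dT _]opprK -dxdT rpredN kideal_dx.
- have -> : contr kk (z - Tp (dT w - dx (kext kk v))) = z1 - Tp g.
    rewrite linearB /= -kmap_contr; congr (_ - kmap _ _).
    rewrite linearB /= -[contr kk _]opprK -kop_contr -[contr kk (dx _)]opprK -kop_contr.
    rewrite contr_kext_kinit // -ev opprK addrC linearB /= contr_kext_kinit //.
    by move/kinitP: hq => -> //; rewrite subr0 addrK.
  apply/ffunP => J; rewrite koszul0E ffunE koszulDE koszulNE linearB /= !ffunE.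
  by rewrite -[in X in _ - X](add0n p) iterDT subrr.
exists (w' + Tp w), (y - Tp (kext kk v)); split.
- by rewrite rpredD // kmap_supp.
- by rewrite submodB // kmap_supp // kext_supp.
- by rewrite linearD /= dw' dx_kmap dw linear0 addr0.
rewrite linearD linearB /= dT_iterT dx_kmap addrACA -linearB /= -ey.
by rewrite subrK.
Qed.
End KoszulCycles.
(** * Relative regularity and powers of the ideal of a d-sequence *)

Section DSequences.
Variables (R : comNzRingType) (r : nat) (x : 'I_r -> R) (M : lmodType R).

Lemma scale_sub_span (X : R^o -> Prop) (Q : submodClosed M) k :
    (forall a, X a <-> exists2 l : 'I_r, (l < k)%N & a = x l) ->
  scale_sub (Defs.span X) Q =i lincomb x Q k.
Proof.
move=> hX v; apply/idP/idP; last first.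
  apply: lincomb_min => l u lk hu; apply: mem_span; exists (x l), u; split=> //.
  by apply: mem_span; apply/hX; exists l.
apply: span_min => _ [a [u [ha hu ->]]].
have hP : submodP (fun b : R^o => (b : R) *: u \in lincomb x Q k).
  split=> [|c b b' hb hb']; first by rewrite scale0r rpred0.
  by rewrite scalerDl rpredD // -scalerA rpredZ.
apply/(mksubP hP); move: a ha; apply: span_min => _ /hX[l lk ->].
by apply/mksubP; apply: lincomb_in.
Qed.

Lemma initial_subE (i : 'I_r) : initial_sub x M i =i init_sub x M i.
Proof. by apply: scale_sub_span. Qed.

Lemma pow_subS n :
  pow_sub M (xideal x) n.+1 =i lincomb x (pow_sub M (xideal x) n) r.
Proof.
by apply: scale_sub_span => a; split=> [[l ->]|[l _ ->]]; exists l.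
Qed.

Local Notation I := (xideal x).

Lemma lincomb_init (Q : submodClosed M) k v : v \in lincomb x Q k -> v \in init_sub x M k.
Proof. by apply: (lincomb_map (g := idfun)) => u _; apply: mem_sub_full. Qed.

Lemma pow_sub_init n v : v \in pow_sub M I n.+1 -> v \in init_sub x M r.
Proof. by rewrite pow_subS; apply: lincomb_init. Qed.

Hypothesis x_dseq : d_sequence x M.

(** Descend from [(x_1, ..., x_r)M] to [(x_1, ..., x_k)M] one variable at a
time.  If [v = w + x_j m] with [w] in [(x_1, ..., x_(j-1))M], then [x_j v] lies
in [(x_1, ..., x_k)M] because [x_k x_j v] does, so that [x_j x_j m], and hence
[x_j m], lies in [(x_1, ..., x_(j-1))M]. *)
Lemma dseq_rel_regular : rel_regular x M.
Proof.
move=> k v hkv hr; suff h j : (j + k <= r)%N -> v \in init_sub x M (j + k) ->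
    v \in init_sub x M k.
  by apply: (h (r - k)%N); rewrite subnK // ltnW.
elim: j => [|j IH] jkr; first by rewrite add0n.
rewrite addSn in jkr *; move=> hv; apply: IH; first exact: ltnW.
pose l : 'I_r := Ordinal jkr.
have kl : (k <= l)%N by rewrite leq_addl.
have hlv : x l *: v \in init_sub x M k.
  by rewrite -initial_subE -(x_dseq kl) initial_subE mulrC -scalerA rpredZ.
have [w [m [hw _ e]]] := lincombS (k := l) hv.
rewrite e rpredD // -[_ \in _](initial_subE l) -(x_dseq (leqnn l)) initial_subE.
have -> : (x l * x l) *: m = x l *: v - x l *: w.
  by rewrite e scalerDr addrC addKr scalerA.
by apply: submodB; [apply: lincomb_le kl hlv | apply: rpredZ].
Qed.

(** Induction on [n] and descent on [k].  By descent [v = w + y u] with [y] the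
next element of the sequence, [w] in [(x_1, ..., x_k) I^n M] and [u] in
[I^n M].  Then [y u] lies in [(x_1, ..., x_k)M], so relative regularity and the
induction hypothesis put [u] in [(x_1, ..., x_k) I^(n-1) M]. *)
Lemma dseq_inter_pow n k v : (k <= r)%N -> v \in init_sub x M k ->
  v \in pow_sub M I n.+1 -> v \in lincomb x (pow_sub M I n) k.
Proof.
elim: n k v => [|n IHn] k v kr hv hp; first exact: hv.
have [j] : exists j, (j + k = r)%N by exists (r - k)%N; rewrite subnK.
elim: j k kr hv => [|j IHj] k kr hv jk; first by rewrite add0n in jk; rewrite jk -pow_subS.
have kr' : (k < r)%N by rewrite -jk addSn ltnS leq_addl.
have := IHj k.+1 kr' (lincomb_le (leqnSn k) hv).
rewrite addnS -addSn => /(_ jk) /(lincombS (k := Ordinal kr'))[w [u [hw hu e]]].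
rewrite e rpredD //; set l := Ordinal kr' in e *.
have hlu : x l *: u \in init_sub x M k.
  have -> : x l *: u = v - w by rewrite e addrC addKr.
  by rewrite submodB // (lincomb_init hw).
have hu' := dseq_rel_regular (k := l) hlu (pow_sub_init hu).
apply: (lincomb_map (g := @scalem R M (x l))) (IHn k u kr hu' hu).
by move=> t ht; apply: mulx_pow.
Qed.

Lemma dseq_colon_pow n (k : 'I_r) v : x k *: v \in init_sub x M k ->
  v \in pow_sub M I n.+1 -> v \in lincomb x (pow_sub M I n) k.
Proof.
move=> hv hp; apply: dseq_inter_pow => //; first exact: ltnW.
exact: dseq_rel_regular (pow_sub_init hp).
Qed.
End DSequences.

(** * Polynomials with coefficients in a module *)

Section PolynomialsOverModule.
Variables (R : comNzRingType) (r : nat) (x : 'I_r -> R) (M : lmodType R).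
Local Notation PM := (dsum (fun _ : 'X_{1..r} => M)).
Implicit Types (a b : 'X_{1..r}) (f F G : PM) (k l : 'I_r).
Local Notation T := (tens_T (r := r) M).

Definition dcoord a f : M := f a.
Fact dcoord_linear a : linear (dcoord a). Proof. by []. Qed.
HB.instance Definition _ a := GRing.isLinear.Build R PM M *:%R (dcoord a) (dcoord_linear a).

Lemma mon_inE a b (v : M) : mon_in M a v b = if a == b then v else 0.
Proof. by case: eqP => [<-|/eqP ne]; rewrite ?ds_inE // ds_inN. Qed.

Lemma tens_TE k f b : T k f b = if (0 < b k)%N then f (b - U_(k))%MM else 0.
Proof.
move: f; apply: ds_ind => [|u v eu ev|a v].
- by rewrite linear0 /= if_same.
- by rewrite linearD !dsDE eu ev; case: ifP; rewrite ?addr0.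
rewrite [ds_in v]/(mon_in M a v) tens_T_in !mon_inE; have [hb|hb] := ltnP 0 (b k).
  have le : (U_(k) <= b)%MM by rewrite lep1mP -lt0n.
  by rewrite -[in LHS](submK le) eqm_add2r.
by case: eqP => // e; move: hb; rewrite -e mnmDE mnm1E eqxx addn1.
Qed.

Fact shift_down_fin k f : exists s : seq 'X_{1..r},
  forall a, a \notin s -> f (a + U_(k))%MM = 0.
Proof.
have [s hs] := ds_finite f; exists [seq (b - U_(k))%MM | b <- s] => a ha.
by apply: hs; apply: contra ha => hb; apply/mapP; exists (a + U_(k))%MM; rewrite ?addmK.
Qed.
Definition shift_down k f : PM := DSum (shift_down_fin k f).
Fact shift_down_linear k : linear (shift_down k).
Proof. by move=> c f g; apply: dsum_ext. Qed.
HB.instance Definition _ k :=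
  GRing.isLinear.Build R PM PM *:%R (shift_down k) (shift_down_linear k).
Local Notation D := shift_down.

Lemma shift_downK k f : D k (T k f) = f.
Proof.
by apply: dsum_ext => a; rewrite /= tens_TE mnmDE mnm1E eqxx addn1 addmK.
Qed.

Lemma shift_downC k l f : l != k -> D k (T l f) = T l (D k f).
Proof.
move=> lk; apply: dsum_ext => a /=; rewrite !tens_TE /= mnmDE mnm1E eq_sym (negPf lk) addn0.
case: ifP => // hl; congr (f _); have le : (U_(l) <= a)%MM by rewrite lep1mP -lt0n.
by rewrite -[in LHS](submK le) -addmA [(U_(l) + _)%MM]addmC addmA addmK.
Qed.

Lemma shift_down_nil k f : exists p, iter p (D k) f = 0.
Proof.
have e p g a : iter p (D k) g a = g (a + U_(k) *+ p)%MM.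
  elim: p g a => [|p IH] g a; first by rewrite mulm0n addm0.
  by rewrite iterSr IH /= mulmS -!addmA; congr (g (_ + _)%MM); rewrite addmC.
exists (\max_(b <- ds_supp f) b k).+1; apply: dsum_ext => a; rewrite e ds0E.
apply: ds_suppN; apply/negP => h.
have : ((a + U_(k) *+ (\max_(b <- ds_supp f) b k).+1)%MM k
  <= \max_(b <- ds_supp f) b k)%N by apply: leq_bigmax_seq.
by rewrite mnmDE mulmnE mnm1E eqxx mul1n addnS ltnNge leq_addl.
Qed.

Lemma init_sub_poly (k : nat) f :
  f \in init_sub x PM k <-> forall a, f a \in init_sub x M k.
Proof.
split=> [hf a|hf].
  by apply: (lincomb_map (g := dcoord a)) hf => u _; apply: mem_sub_full.
have h a : exists u : 'I_r -> M, f a = \sum_(l < r | (l < k)%N) x l *: u l /\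
    (f a = 0 -> forall l, u l = 0).
  have [->|ne] := eqVneq (f a) 0.
    by exists (fun=> 0); split=> //; rewrite big1 // => l _; rewrite scaler0.
  have /mksubP[u [_ e]] := hf a; exists u; split=> // /eqP.
  by rewrite (negPf ne).
have [u hu] := choice h; have fin l : exists s : seq 'X_{1..r},
    forall a, a \notin s -> u a l = 0.
  by have [s hs] := ds_finite f; exists s => a /hs e; apply: (proj2 (hu a) e).
apply/mksubP; exists (fun l => DSum (fin l)); split=> [l|]; first exact: mem_sub_full.
by apply: dsum_ext => a; rewrite (proj1 (hu a)) -[RHS]/(dcoord a _) linear_sum.
Qed.

Lemma rel_regular_poly : rel_regular x M -> rel_regular x PM.
Proof.
move=> reg k f hk hr; apply/(init_sub_poly k f) => a.
by apply: reg;
  [exact: (iffLR (init_sub_poly k _) hk) | exact: (iffLR (init_sub_poly r _) hr)].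
Qed.

Definition hpart_prop n f := forall a, mdeg a != n -> f a = 0.
Fact submodP_hpart n : submodP (hpart_prop n).
Proof.
split=> [a _ //|c f g hf hg a ha].
by rewrite dsDE dsZE hf ?hg // scaler0 addr0.
Qed.
Definition hpart n : submodClosed PM := mksub (submodP_hpart n).

Lemma mon_in_homog a v : mon_in M a v \in hpart (mdeg a).
Proof. by apply/mksubP => b; rewrite mon_inE; have [<-|] := eqVneq a b; rewrite ?eqxx. Qed.

Lemma tens_T_homog k n f : f \in hpart n -> T k f \in hpart n.+1.
Proof.
move=> /mksubP hf; apply/mksubP => a ha; rewrite tens_TE; case: ifP => // ak.
apply: hf; have le : (U_(k) <= a)%MM by rewrite lep1mP -lt0n.
by move: ha; rewrite -[in mdeg a](submK le) mdegD mdeg1 addn1 eqSS.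
Qed.

Lemma homogS n f : f \in hpart n.+1 ->
  exists g : 'I_r -> PM, (forall l, g l \in hpart n) /\ f = \sum_l T l (g l).
Proof.
move=> /mksubP hf; rewrite [f]ds_decomp.
pose P u := exists g : 'I_r -> PM, (forall l, g l \in hpart n) /\ u = \sum_l T l (g l).
apply: (big_ind P) => [|u v [g [hg ->]] [h [hh ->]]|a _].
- exists (fun=> 0); split=> [l|]; first exact: rpred0.
  by rewrite big1 // => l _; rewrite linear0.
- exists (fun l => g l + h l); split=> [l|]; first by rewrite rpredD.
  by rewrite -big_split; apply: eq_bigr => l _; rewrite linearD.
have [ea|ne] := eqVneq (mdeg a) n.+1; last first.
  exists (fun=> 0); split=> [l|]; first exact: rpred0.
  by rewrite hf // linear0 big1 // => l _; rewrite linear0.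
have [k ak] : exists k, (0 < a k)%N.
  apply/existsP; apply: contraT => /existsPn h; move: ea; rewrite mdegE big1 //.
  by move=> k _; apply/eqP; rewrite -leqn0 leqNgt; apply: h.
have le : (U_(k) <= a)%MM by rewrite lep1mP -lt0n.
exists (fun l => if l == k then mon_in M (a - U_(k))%MM (f a) else 0); split=> [l|].
  case: ifP => _; last exact: rpred0.
  suff -> : n = mdeg (a - U_(k))%MM by apply: mon_in_homog.
  by apply/eqP; rewrite -eqSS -ea -[in mdeg a](submK le) mdegD mdeg1 addn1.
rewrite (bigD1 k) //= eqxx tens_T_in submK // big1 ?addr0 // => l /negPf ->.
exact: linear0.
Qed.

Definition evalx : {linear PM -> M} :=
  @ds_lift R _ (fun _ : 'X_{1..r} => M) M (fun a => @scalem R M (xmon x a)).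

Lemma evalx_mon a v : evalx (mon_in M a v) = xmon x a *: v.
Proof. exact: ds_lift_in. Qed.

Lemma evalx_T k f : evalx (T k f) = x k *: evalx f.
Proof.
move: f; apply: ds_ind => [|u v eu ev|a v]; first by rewrite !linear0 ?scaler0.
  by rewrite !linearD eu ev.
by rewrite [ds_in v]/(mon_in M a v) tens_T_in !evalx_mon xmonU scalerA.
Qed.

Lemma evalx_hpart0 f : f \in hpart 0 -> evalx f = 0 -> f = 0.
Proof.
move=> /mksubP hf; have -> : f = mon_in M 0%MM (f 0%MM).
  apply: dsum_ext => a; rewrite mon_inE; case: eqP => [<- //|/eqP].
  by rewrite eq_sym -mdeg_eq0 => /hf.
rewrite evalx_mon /xmon big1 ?scale1r => [->|k _]; first exact: linear0.
by rewrite mnm0E.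
Qed.

Local Notation I := (xideal x).

Lemma evalx_pow n f : f \in hpart n -> evalx f \in pow_sub M I n.
Proof.
move=> /mksubP hf; rewrite [f]ds_decomp linear_sum; apply: rpred_sum => a _.
have [<-|ne] := eqVneq (mdeg a) n; last by rewrite hf // !linear0 rpred0.
rewrite [ds_in _]/(mon_in M a _) evalx_mon -[mdeg a]addn0.
exact/xmon_pow/mem_sub_full.
Qed.

Lemma pow_evalx n v : v \in pow_sub M I n -> exists2 f, f \in hpart n & v = evalx f.
Proof.
elim: n v => [|n IH] v.
  move=> _; exists (mon_in M 0%MM v); first by rewrite -[0%N](@mdeg0 r) mon_in_homog.
  by rewrite evalx_mon /xmon big1 ?scale1r // => k _; rewrite mnm0E.
rewrite pow_subS => /mksubP[u [hu ->]].
have /choice[f hf] l : exists f, f \in hpart n /\ u l = evalx f.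
  by have [f hf e] := IH (u l) (hu l); exists f.
exists (\sum_l T l (f l)).
  by apply: rpred_sum => l _; apply: tens_T_homog; case: (hf l).
rewrite linear_sum big_mkcond; apply: eq_bigr => l _ /=.
by rewrite ltn_ord evalx_T -(hf l).2.
Qed.
End PolynomialsOverModule.
(** * Polynomials that vanish at the sequence *)

Section LinearType.
Variables (R : comNzRingType) (r : nat) (x : 'I_r -> R) (M : lmodType R).
Local Notation PM := (dsum (fun _ : 'X_{1..r} => M)).
Local Notation T := (tens_T (r := r) M).
Local Notation I := (xideal x).
Local Notation dx := (kop (xmul x PM)).
Local Notation dT := (kop T).

Lemma dT_kmapT k f : dT (kmap (T k) f) = kmap (T k) (dT f).
Proof.
rewrite /kop linear_sum; apply: eq_bigr => l _ /=; rewrite -kmap_contr.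
by apply/ffunP => J; rewrite !ffunE tens_TC.
Qed.

Fact submodP_syz : submodP (fun f : PM => exists w,
  [/\ w \in ksupp r PM 1, dx w = 0 & dT w = kconst r f]).
Proof.
split=> [|c f g [u [ui du eu]] [v [vi dv ev]]].
  by exists 0; rewrite rpred0 !linear0.
exists (c *: u + v); rewrite rpredD ?rpredZ //.
by rewrite !linearP /= du dv eu ev scaler0 addr0.
Qed.

(** The submodule generated over the polynomial ring by the linear forms
[\sum_k T_k v_k] with [\sum_k x_k v_k = 0]. *)
Definition syz : submodClosed PM := mksub submodP_syz.

Lemma syz_T k f : f \in syz -> T k f \in syz.
Proof.
move=> /mksubP[w [wi dw ew]]; apply/mksubP; exists (kmap (T k) w); split.
- exact: kmap_supp.
- by rewrite dx_kmap dw linear0.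
by rewrite dT_kmapT ew kmap_kconst.
Qed.

Hypothesis x_dseq : d_sequence x M.

(** A form [T_1 F_1 + ... + T_k F_k] that vanishes at [x] is a combination of
linear syzygies, by induction on the degree and on [k].  The value of [F_k]
lies in [(x_1, ..., x_(k-1))M : x_k] and in a power of [(x)], hence it is also
the value of a form [H] in the ideal [(T_1, ..., T_(k-1))].  The form [F_k - H]
has smaller degree and vanishes at [x], and replacing [F_k] by [H] leaves a
form in [(T_1, ..., T_(k-1))]. *)
Lemma linear_type n k (F : 'I_r -> PM) : (k <= r)%N ->
    (forall l, F l \in hpart r M n) ->
    evalx x M (\sum_(l < r | (l < k)%N) T l (F l)) = 0 ->
  \sum_(l < r | (l < k)%N) T l (F l) \in syz.
Proof.
elim: n k F => [|n IHn] k F kr hF.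
  rewrite linear_sum => e0; apply/mksubP.
  exists (\sum_(l < r | (l < k)%N) kext l (kconst r (F l))); split.
  - by apply: rpred_sum => l _; apply/kext_supp/kconst_supp.
  - have c0 : \sum_(l < r | (l < k)%N) x l *: F l = 0.
      apply: (@evalx_hpart0 _ _ x).
        by apply: rpred_sum => l _; apply: rpredZ.
      rewrite linear_sum -[RHS]e0; apply: eq_bigr => l _.
      by rewrite evalx_T linearZ.
    rewrite linear_sum -[RHS](linear0 (@kconst R r PM)) -c0 linear_sum.
    by apply: eq_bigr => l _; rewrite /= kop_kext_kconst.
  by rewrite !linear_sum; apply: eq_bigr => l _; rewrite /= kop_kext_kconst.
elim: k F kr hF => [|k IHk] F kr hF; first by rewrite big_pred0 ?rpred0.
pose kk := Ordinal kr; rewrite (sum_ltS kk) linearD evalx_T /= => e0.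
have : evalx x M (F kk) \in lincomb x (pow_sub M I n) k.
  apply: (dseq_colon_pow x_dseq (k := kk)); last exact: evalx_pow.
  move/eqP: e0; rewrite addrC addr_eq0 => /eqP ->; rewrite rpredN linear_sum.
  by apply: rpred_sum => l lk; rewrite evalx_T lincomb_in ?mem_sub_full.
move=> /mksubP[u [hu eu]].
have /choice[H hH] l : exists h, h \in hpart r M n /\ u l = evalx x M h.
  by have [h ? ?] := pow_evalx (hu l); exists h.
pose HH := \sum_(l < r | (l < k)%N) T l (H l).
have eH : evalx x M (F kk) = evalx x M HH.
  by rewrite eu linear_sum; apply: eq_bigr => l _; rewrite evalx_T (hH l).2.
have [|g [hg eg]] := @homogS _ _ M n (F kk - HH).
  by rewrite submodB //; apply: rpred_sum => l _; apply: tens_T_homog (hH l).1.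
have hs : F kk - HH \in syz.
  have := IHn r g (leqnn r) hg.
  rewrite (eq_bigl xpredT) => [|l]; last exact: ltn_ord.
  by rewrite -eg linearB /= eH subrr => ->.
have -> : \sum_(l < r | (l < k)%N) T l (F l) + T kk (F kk) =
    \sum_(l < r | (l < k)%N) T l (F l + T kk (H l)) + T kk (F kk - HH).
  rewrite linearB /= [X in _ = X + _](eq_bigr (fun l => T l (F l) + T kk (T l (H l)))).
    by rewrite big_split /= -linear_sum -/HH addrACA subrr addr0.
  by move=> l _; rewrite linearD /= tens_TC.
have hF' l : F l + T kk (H l) \in hpart r M n.+1.
  by rewrite rpredD // tens_T_homog // (hH l).1.
rewrite rpredD ?syz_T // IHk ?(ltnW kr) //.
rewrite -[RHS]e0 (eq_bigr (fun l => T l (F l) + T kk (T l (H l)))); last first.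
  by move=> l _; rewrite linearD /= tens_TC.
by rewrite big_split /= -linear_sum -/HH linearD /= evalx_T eH.
Qed.

(** If the value of [F] lies in [I^(n+1) M], it is also the value of a form
[\sum_l x_l g_l] of degree [n]; their difference vanishes at [x] and is thus a
combination of linear syzygies, while [\sum_l x_l g_l] is a boundary. *)
Lemma evalx_kernel n (F : PM) : F \in hpart r M n ->
    evalx x M F \in pow_sub M I n.+1 ->
  exists w y, [/\ w \in ksupp r PM 1, y \in ksupp r PM 1, dx w = 0
    & kconst r F = dT w + dx y].
Proof.
move=> hF /pow_evalx[G /homogS[g [hg ->]]] eG.
pose F0 := F - \sum_l x l *: g l.
have hF0 : F0 \in hpart r M n.
  by rewrite submodB //; apply: rpred_sum => l _; apply: rpredZ.
have e0 : evalx x M F0 = 0.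
  apply/eqP; rewrite linearB subr_eq0 eG !linear_sum; apply/eqP.
  by apply: eq_bigr => l _; rewrite evalx_T linearZ.
have : F0 \in syz.
  case: n hF hF0 eG hg => [|n] hF hF0 eG hg; first by rewrite (evalx_hpart0 hF0 e0) rpred0.
  have [f [hf ef]] := homogS hF0.
  have := linear_type (leqnn r) hf; rewrite (eq_bigl xpredT) => [|l]; last exact: ltn_ord.
  by rewrite -ef; apply.
move=> /mksubP[w [wi dw ew]].
have [|y [_ yi ey]] := @init_sub_dx _ _ x PM r (\sum_l x l *: g l).
  by apply: rpred_sum => l _; rewrite lincomb_in ?mem_sub_full.
exists w, y; split=> //; rewrite ew -ey -linearD.
by rewrite /F0 subrK.
Qed.
End LinearType.

(** * Exactness of the approximation complex *)

Section Representatives.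
Variables (R : comNzRingType) (r : nat) (x : 'I_r -> R) (M : lmodType R).
Local Notation PM := (dsum (fun _ : 'X_{1..r} => M)).
Local Notation T := (tens_T (r := r) M).
Local Notation I := (xideal x).
Local Notation dx := (kop (xmul x PM)).
Local Notation dT := (kop T).
Implicit Types (a b : 'X_{1..r}) (f : koszul r PM).

Definition slice a f : koszul r M := [ffun J => f J a].
Fact slice_linear a : linear (slice a).
Proof. by move=> c f g; apply/ffunP => J; rewrite koszulDE koszulZE !ffunE. Qed.
HB.instance Definition _ a :=
  GRing.isLinear.Build R (koszul r PM) (koszul r M) *:%R (slice a) (slice_linear a).

Lemma slice_contr a k f : slice a (contr k f) = contr k (slice a f).
Proof. by apply/ffunP => J; rewrite !ffunE; case: ifP. Qed.

Lemma slice_dx a f : slice a (dx f) = kdiff x (slice a f).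
Proof.
rewrite linear_sum; apply: eq_bigr => k _.
by rewrite /= kmap_xmul linearZ /= slice_contr.
Qed.

Lemma slice_dT b f : slice b (dT f) =
  \sum_k if (0 < b k)%N then contr k (slice (b - U_(k))%MM f) else 0.
Proof.
rewrite linear_sum; apply: eq_bigr => k _; apply/ffunP => J.
rewrite ffunE ffunE tens_TE; case: ifP => _; last by rewrite koszul0E.
by rewrite -slice_contr [RHS]ffunE.
Qed.

Lemma slice_eq f g : (forall a, slice a f = slice a g) -> f = g.
Proof.
move=> h; apply/ffunP => J; apply: dsum_ext => a.
by have /(congr1 (fun u : koszul r M => u J)) := h a; rewrite !ffunE.
Qed.

Lemma slice_suppP i f : (forall a, slice a f \in ksupp r M i) <-> f \in ksupp r PM i.
Proof.
split=> [h|/mksubP h a].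
  apply/mksubP => J hJ; apply: dsum_ext => a; have /mksubP/(_ J hJ) := h a.
  by rewrite ffunE.
by apply/mksubP => J hJ; rewrite ffunE h.
Qed.

Lemma slice_fin f : exists s : seq 'X_{1..r}, forall a, a \notin s -> slice a f = 0.
Proof.
have /choice[s hs] J := ds_finite (f J).
exists (flatten [seq s J | J <- enum {set 'I_r}]) => a ha.
apply/ffunP => J; rewrite koszul0E ffunE; apply: hs; apply: contra ha => aJ.
by apply/flatten_mapP; exists J; rewrite ?mem_enum.
Qed.

Lemma slice_glue (s : seq 'X_{1..r}) (g : 'X_{1..r} -> koszul r M) :
  (forall a, a \notin s -> g a = 0) -> exists f, forall a, slice a f = g a.
Proof.
move=> hs; have fin J : exists s : seq 'X_{1..r}, forall a, a \notin s -> g a J = 0.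
  by exists s => a /hs ->; rewrite koszul0E.
exists [ffun J => DSum (fin J)] => a; apply/ffunP => J.
by rewrite !ffunE.
Qed.

(** A relation instead of the function [cls], whose argument is a membership
proof that would have to be carried through sums. *)
Definition is_cls (V : lmodType R) (Z B : submodClosed V) (q : subquo Z B) y :=
  exists h : y \in Z, q = cls B h.

Section IsCls.
Variables (V : lmodType R) (Z B : submodClosed V).
Implicit Types (q p : subquo Z B) (y z : V).

Lemma is_cls_lin c q p y z : is_cls q y -> is_cls p z -> is_cls (c *: q + p) (c *: y + z).
Proof.
move=> [hy ->] [hz ->]; have h : c *: y + z \in Z by rewrite rpredD ?rpredZ.
by exists h; rewrite /cls -linearP; congr quom_pi; apply: val_inj.
Qed.

Lemma is_cls0 : is_cls (0 : subquo Z B) 0.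
Proof.
exists (rpred0 Z); rewrite -[LHS](linear0 (quom_pi _)); congr quom_pi.
exact: val_inj.
Qed.

Lemma is_cls_eq0 q y : is_cls q y -> q = 0 <-> y \in B.
Proof.
move=> [h ->]; have [h0 ->] := is_cls0.
by rewrite -[y in X in _ <-> X]subr0; apply: clsE.
Qed.

Lemma is_clsD q p y z : is_cls q y -> is_cls p z -> is_cls (q + p) (y + z).
Proof. by move=> hq hp; have := is_cls_lin 1 hq hp; rewrite !scale1r. Qed.

Lemma is_clsB q p y z : is_cls q y -> is_cls p z -> is_cls (q - p) (y - z).
Proof.
move=> hq hp; rewrite addrC [y - z]addrC -[- p]scaleN1r -[- z]scaleN1r.
exact: is_cls_lin.
Qed.
End IsCls.

Lemma is_cls_contr k i (q : khom x M i.+1) y : is_cls q y ->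
  is_cls (kcontr x M k i q) (contr k y).
Proof. by move=> [h ->]; exists (contr_cycle k h); rewrite kcontr_cls. Qed.

(** Elements of [H_i(x; M) (x) S] are handled through cycles of the Koszul
complex of [x] with coefficients in [M[T]], compared coefficient by
coefficient. *)
Definition represents i (z : tens r i (khom x M i)) f : Prop :=
  forall a, is_cls ((z : dsum _) a) (slice a f).

Lemma represents_ex i (z : tens r i (khom x M i)) :
  exists f, represents z f /\ forall a, (z : dsum _) a = 0 -> slice a f = 0.
Proof.
have /choice[g hg] a : exists y : koszul r M, is_cls ((z : dsum _) a) y /\
    ((z : dsum _) a = 0 -> y = 0).
  have [e|ne] := pselect ((z : dsum _) a = 0).
    by exists 0; rewrite e; split=> //; exact: is_cls0.
  by have [y [h e]] := clsP ((z : dsum _) a); exists y; split=> //; exists h.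
have [s hs] := ds_finite z; have [a ha|f hf] := @slice_glue s g.
  by apply: (hg a).2; apply: hs.
by exists f; split=> a; rewrite hf; have [] := hg a.
Qed.

Lemma represents_cycle i (z : tens r i (khom x M i)) f : represents z f ->
  f \in ksupp r PM i /\ dx f = 0.
Proof.
move=> h; split.
  by apply/slice_suppP => a; have [hc _] := h a; have /mksubP[] := hc.
apply: slice_eq => a; rewrite slice_dx linear0.
by have [hc _] := h a; have /mksubP[] := hc.
Qed.

Lemma represents_of i f : f \in ksupp r PM i -> dx f = 0 ->
  exists z : tens r i (khom x M i), represents z f.
Proof.
move=> fi df; have h a : slice a f \in kcycle x M i.
  apply/mksubP; split; first by move: a; apply/slice_suppP.
  by rewrite -slice_dx df linear0.
have fin : exists s : seq 'X_{1..r}, forall a, a \notin s -> cls (kbound x M i) (h a) = 0.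
  have [s hs] := slice_fin f; exists s => a /hs e.
  by apply/(is_cls_eq0 (y := slice a f)); [exists (h a) | rewrite e rpred0].
by exists (DSum fin) => a; exists (h a).
Qed.

Lemma represents_sub i (z z' : tens r i (khom x M i)) f f' :
  represents z f -> represents z' f' -> represents (z - z') (f - f').
Proof.
move=> h h' a; rewrite linearB.
have -> : (z - z' : dsum _) a = (z : dsum _) a - (z' : dsum _) a.
  exact: (linearB (dcoord (r := r) (M := khom x M i) a)).
exact: is_clsB.
Qed.

Lemma represents_eq0 i (z : tens r i (khom x M i)) f : represents z f ->
  z = 0 <-> exists2 y, y \in ksupp r PM i.+1 & f = dx y.
Proof.
move=> h; split=> [z0|[y yi ey]]; last first.
  apply: dsum_ext => a; apply/(is_cls_eq0 (h a)); apply/mksubP.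
  exists (slice a y); first by move: a; apply/slice_suppP.
  by rewrite ey slice_dx.
have hb a : slice a f \in kbound x M i by apply/(is_cls_eq0 (h a)); rewrite z0.
have /choice[g hg] a : exists y, [/\ y \in ksupp r M i.+1, slice a f = kdiff x y
    & slice a f = 0 -> y = 0].
  have [e|ne] := eqVneq (slice a f) 0; first by exists 0; rewrite rpred0 linear0.
  have /mksubP[y yi e] := hb a; exists y; split=> // e0.
  by rewrite e0 eqxx in ne.
have [s hs] := slice_fin f; have [a ha|y hy] := @slice_glue s g.
  by have [_ _] := hg a; apply; apply: hs.
exists y; first by apply/slice_suppP => a; rewrite hy; have [] := hg a.
by apply: slice_eq => a; rewrite slice_dx hy; have [] := hg a.
Qed.

Lemma apx_dE i (z : tens r i.+1 (khom x M i.+1)) b :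
  (apx_d x M i z : dsum _) b =
  \sum_k if (0 < b k)%N then kcontr x M k i ((z : dsum _) (b - U_(k))%MM) else 0.
Proof.
move: z; apply: ds_ind => [|u v eu ev|a h].
- rewrite linear0 big1 // => k _; case: ifP => // _; exact: linear0.
- rewrite (linearD (apx_d x M i)) dsDE eu ev -big_split; apply: eq_bigr => k _ /=.
  by case: ifP; rewrite ?addr0 // linearD.
rewrite [X in (X : dsum _) b](apx_d_inE a h) ds_sumE; apply: eq_bigr => k _.
rewrite /tens_in -tens_T_in tens_TE; case: ifP => // _.
by rewrite [ds_in h]/(mon_in _ a h) !mon_inE; case: ifP; rewrite ?linear0.
Qed.

Lemma represents_d i (z : tens r i.+1 (khom x M i.+1)) f :
  represents z f -> represents (apx_d x M i z) (dT f).
Proof.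
move=> h b; rewrite apx_dE slice_dT.
apply: (big_ind2 (@is_cls _ _ _)) => [||k _]; first exact: is_cls0.
  by move=> *; apply: is_clsD.
by case: ifP => _; [apply: is_cls_contr | apply: is_cls0].
Qed.

Lemma represents_exact i (z : tens r i (khom x M i)) f w y : represents z f ->
    w \in ksupp r PM i.+1 -> y \in ksupp r PM i.+1 -> dx w = 0 -> f = dT w + dx y ->
  exists v, z = apx_d x M i v.
Proof.
move=> hz wi yi dw ef; have [v hv] := represents_of wi dw; exists v.
have h := represents_sub hz (represents_d hv).
apply/eqP; rewrite -subr_eq0; apply/eqP/(represents_eq0 h).
by exists y => //; rewrite ef addrC addKr.
Qed.
End Representatives.
Section Augmentation.
Variables (R : comNzRingType) (r : nat) (x : 'I_r -> R) (M : lmodType R).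
Local Notation PM := (dsum (fun _ : 'X_{1..r} => M)).
Local Notation T := (tens_T (r := r) M).
Local Notation I := (xideal x).
Local Notation dx := (kop (xmul x PM)).
Local Notation dT := (kop T).

(** The analogue of [is_cls] for elements of degree [n].  Having [n] as a
parameter allows sums of classes in pieces whose degrees are equal to [n] by a
proof only. *)
Definition is_gr_cls n (q : gr x M) (v : M) :=
  exists h : v \in pow_sub M I n, q = ds_in (cls (pow_sub M I n.+1) h : gr_piece x M n).

Lemma is_gr_clsP n q v : is_gr_cls n q v <->
  exists2 p : gr_piece x M n, is_cls p v & q = ds_in p.
Proof.
by split=> [[h ->]|[_ [h ->] ->]]; [exists (cls _ h) => //; exists h | exists h].
Qed.

Lemma is_gr_cls0 n : is_gr_cls n 0 0.
Proof. by apply/is_gr_clsP; exists 0; [exact: is_cls0 | rewrite linear0]. Qed.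

Lemma is_gr_clsD n q q' v v' :
  is_gr_cls n q v -> is_gr_cls n q' v' -> is_gr_cls n (q + q') (v + v').
Proof.
move=> /is_gr_clsP[p hp ->] /is_gr_clsP[p' hp' ->]; apply/is_gr_clsP.
exists (p + p'); first exact: is_clsD.
by rewrite linearD.
Qed.

Lemma is_gr_cls_eq0 n v : is_gr_cls n 0 v -> v \in pow_sub M I n.+1.
Proof.
move=> /is_gr_clsP[p hp e]; apply/(is_cls_eq0 hp).
by rewrite -(ds_inE (N := gr_piece x M) p) -e.
Qed.

Lemma aug_represents n (z : tens r 0 (khom x M 0)) f :
    represents z f -> f set0 \in hpart r M n ->
  is_gr_cls n (aug x M z) (evalx x M (f set0)).
Proof.
move=> hz /mksubP hf; pose s := undup (ds_supp (z : dsum _) ++ ds_supp (f set0)).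
have us : uniq s by apply: undup_uniq.
have hzs a : a \notin s -> (z : dsum _) a = 0.
  by rewrite mem_undup mem_cat negb_or => /andP[/ds_suppN].
have hfs a : a \notin s -> f set0 a = 0.
  by rewrite mem_undup mem_cat negb_or => /andP[_ /ds_suppN].
rewrite [aug x M z](ds_liftE _ us hzs) [evalx _ _ _](ds_liftE _ us hfs).
apply: (big_ind2 (is_gr_cls n)) => [||a _].
- exact: is_gr_cls0.
- by move=> *; apply: is_gr_clsD.
have [h ->] := hz a; rewrite -[X in is_gr_cls _ X _]/(aug_in a (cls _ h)) aug_inE.
have e0 : aug0 x a (slice a f) = scalem (xmon x a) (f set0 a) by rewrite /aug0 ffunE.
have [ea|ne] := eqVneq (mdeg a) n; last first.
  have z0 : f set0 a = 0 by apply: hf.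
  rewrite z0 linear0.
  have -> : cls _ (aug_cycle a h) = 0 :> gr_piece x M (mdeg a); last first.
    by rewrite linear0; apply: is_gr_cls0.
  apply/(is_cls_eq0 (y := aug0 x a (slice a f))); first by eexists.
  by rewrite e0 z0 linear0 rpred0.
have hn : scalem (xmon x a) (f set0 a) \in pow_sub M I n.
  by rewrite -e0 -ea; apply: aug_cycle.
by exists hn; apply: gr_in_eq.
Qed.

Lemma aug_surj (w : gr x M) : exists v, aug x M v = w.
Proof.
move: w; apply: ds_ind => [|w w' [v ev] [v' ev']|n q].
- by exists 0; rewrite linear0.
- by exists (v + v'); rewrite linearD ev ev'.
have [v [hv ->]] := clsP q; have [F hF eF] := pow_evalx hv.
have [z hz] : exists z : tens r 0 (khom x M 0), represents z (kconst r F).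
  by apply: represents_of; [exact: kconst_supp | exact: kop_kconst].
have e0 : kconst r F set0 = F by rewrite ffunE eqxx.
have [|h eh] := @aug_represents n z _ hz; first by rewrite e0.
by exists z; rewrite eh; apply: gr_in_eq; rewrite ?e0.
Qed.

Hypothesis x_dseq : d_sequence x M.

(** The gradings reduce the claim to homogeneous elements, which are represented
by forms with coefficients in [M]. *)
Lemma aug_exact v : aug x M v = 0 -> exists w, v = apx_d x M 0 w.
Proof.
move=> ev; have [_ _ _ dd du] := gm_grading (tens r 0 (khom x M 0)).
have [b [c [hc ec]]] := dd v.
have hcw n : (n < b)%N -> exists w, c n = apx_d x M 0 w.
  move=> nb; have ecn : aug x M (c n) = 0.
    have [_ _ _ _ du'] := gm_grading (gr x M).
    apply: (du' b (fun n => aug x M (c n))) nb; first by move=> j; apply: gh_deg.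
    by rewrite -linear_sum -ec.
  have [f [hf f0]] := represents_ex (c n).
  have fn : f set0 \in hpart r M n.
    apply/mksubP => a na; have -> : f set0 a = slice a f set0 by rewrite ffunE.
    by rewrite f0 ?koszul0E //; apply: hc; rewrite /= addn0.
  have := aug_represents hf fn; rewrite ecn => /is_gr_cls_eq0 hp.
  have [w [y [wi yi dw e]]] := evalx_kernel x_dseq fn hp.
  apply: (represents_exact hf wi yi dw); rewrite -e; apply: supp0_kconst.
  by have [] := represents_cycle hf.
have /choice[w hw] (n : 'I_b) : exists w, c n = apx_d x M 0 w by apply: hcw.
exists (\sum_n w n); rewrite ec linear_sum; apply: eq_bigr => n _; exact: hw.
Qed.

Lemma apx_exact i v : apx_d x M i v = 0 -> exists w, v = apx_d x M i.+1 w.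
Proof.
move=> ev; have [f [hf _]] := represents_ex v.
have [fi df] := represents_cycle hf.
have [y yi ey] := iffLR (represents_eq0 (represents_d hf)) ev.
have reg := rel_regular_poly (dseq_rel_regular x_dseq).
have [||w [y' [wi y'i dw e]]] := approx_cycle reg (@tens_TC R r M)
    (@shift_downK R r M) (@shift_downC R r M) (@shift_down_nil R r M)
    (leqnn r) _ fi df.
- exact: kinit_geq.
- by rewrite ey kideal_dx.
exact: represents_exact hf wi y'i dw e.
Qed.

Lemma approx_exact j v : approx_complex x M j v = 0 ->
  exists w, v = approx_complex x M j.+1 w.
Proof. by case: j v => [|i] v; [exact: aug_exact | exact: apx_exact]. Qed.

(** [H_(r+1)(x; M) = 0], so that exactness gives injectivity at the left end. *)
Lemma approx_inj : (0 < r)%N -> injective (approx_complex x M r).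
Proof.
move=> r0 u v e; apply/eqP; rewrite -subr_eq0; apply/eqP.
have [w ->] : exists w, u - v = approx_complex x M r.+1 w.
  by apply: approx_exact; rewrite linearB /= e subrr.
have -> : w = 0; last exact: linear0.
by apply: dsum_ext => a; apply: khom_gt.
Qed.
End Augmentation.
(** * Torsion over a noetherian local ring *)

Section Torsion.
Variables (R : comNzRingType) (m : idealT R).
Hypothesis R_noeth : noetherian R.

(** Otherwise a strictly increasing sequence of proper ideals would start at
[I], and its union would not be finitely generated. *)
Lemma noetherian_maximal (I : idealT R) : is_proper I ->
  exists J : idealT R, maximal_ideal J /\ sub_ideal I J.
Proof.
move=> Iproper; apply: contrapT => none.
have /choice[next hnext] (J : idealT R) : exists J' : idealT R,
    is_proper J -> sub_ideal I J ->
    [/\ is_proper J', sub_ideal J J' & ~ sub_ideal J' J].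
  have [[[pJ IJ] h]|h] := pselect ((is_proper J /\ sub_ideal I J) /\
      exists J', [/\ is_proper J', sub_ideal J J' & ~ sub_ideal J' J]).
    by have [J' hJ'] := h; exists J'.
  exists J => pJ IJ; case: h; split=> //; apply: contrapT => h.
  case: none; exists J; split=> //; split=> // J' pJ' JJ'.
  by apply: contrapT => nJ; apply: h; exists J'.
pose J n := iter n next I.
have hJ n : is_proper (J n) /\ sub_ideal I (J n).
  elim: n => [|n [pn In]] /=; first by split=> // c.
  have [p s _] := hnext _ pn In; split=> // c /In; exact: s.
have J_mono n k c : (n <= k)%N -> c \in (J n : {pred R^o}) -> c \in (J k : {pred R^o}).
  move=> /subnK <-; elim: (k - n)%N => //= j IH /IH.
  by have [pj Ij] := hJ (j + n)%N; have [_ s _] := hnext _ pj Ij; apply: s.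
have hU : submodP (fun c : R^o => exists n, c \in (J n : {pred R^o})).
  split=> [|a u v [n hn] [k hk]]; first by exists 0%N; rewrite rpred0.
  exists (maxn n k); rewrite rpredD ?rpredZ //.
    by apply: J_mono hn; apply: leq_maxl.
  by apply: J_mono hk; apply: leq_maxr.
have [s hs] := R_noeth (mksub hU).
have [N hN] : exists N, forall c, c \in s -> c \in (J N : {pred R^o}).
  have : forall c, c \in s -> exists n, c \in (J n : {pred R^o}).
    by move=> c cs; apply/(mksubP hU); rewrite hs mem_span.
  elim: s {hs} => [|c s IH] h; first by exists 0%N.
  have [n hn] := h c (mem_head _ _); have [|k hk] := IH.
    by move=> d ds; apply: h; rewrite inE ds orbT.
  exists (maxn n k) => d; rewrite inE => /orP[/eqP ->|/hk].
    by apply: J_mono hn; apply: leq_maxl.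
  by apply: J_mono; apply: leq_maxr.
have [pN IN] := hJ N; have [_ _ []] := hnext _ pN IN => c hc.
have : c \in (mksub hU : {pred R^o}) by apply/mksubP; exists N.+1.
by rewrite hs; apply: span_min.
Qed.

Hypothesis R_local : local_ring m.

Lemma local_unit a : a \in (m : {pred R^o}) -> exists b, b * (1 - a) = 1.
Proof.
move=> am; have hI : submodP (fun c : R^o => exists b : R, c = b * (1 - a)).
  split=> [|c _ _ [b ->] [b' ->]]; first by exists 0; rewrite mul0r.
  by exists (c * b + b'); rewrite mulrDl -mulrA.
have [/mksubP[b e]|pI] := boolP ((1 : R^o) \in mksub hI); first by exists b.
have [J [Jmax IJ]] := noetherian_maximal pI.
have [[mproper _] m_unique] := R_local; case/negP: mproper.
have -> : (1 : R) = (1 - a) + a by rewrite subrK.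
apply: (rpredD (V := R^o)) => //; rewrite -(m_unique J Jmax); apply: IJ.
by apply/mksubP; exists 1; rewrite mul1r.
Qed.

Lemma span_cons (V : lmodType R) (u : V) s v :
    v \in Defs.span (fun w => w \in u :: s) ->
  exists c w, w \in Defs.span (fun w => w \in s) /\ v = c *: u + w.
Proof.
pose P v := exists c w, w \in Defs.span (fun w => w \in s) /\ v = c *: u + w.
have hP : submodP P.
  split=> [|a _ _ [c [w [hw ->]]] [c' [w' [hw' ->]]]].
    by exists 0, 0; rewrite rpred0 scale0r addr0.
  exists (a * c + c'), (a *: w + w'); split; first by rewrite rpredD ?rpredZ.
  by rewrite scalerDr scalerA scalerDl addrACA.
move=> hv; apply/(mksubP hP); move: hv; apply: span_min => t.
rewrite inE => ht; apply/mksubP; case/orP: ht => [/eqP ->|ts].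
  by exists 1, 0; rewrite rpred0 scale1r addr0.
by exists 0, t; rewrite scale0r add0r; split=> //; apply: mem_span.
Qed.

Lemma nakayama (V : lmodType R) (s : seq V) :
    (forall u, u \in s -> u \in scale_sub m (Defs.span (fun w => w \in s))) ->
  forall u, u \in s -> u = 0.
Proof.
elim: s => [|u0 s IH] // hs.
pose Q := scale_sub m (Defs.span (fun w => w \in s)).
pose P v := exists a w, [/\ a \in (m : {pred R^o}), w \in Q & v = a *: u0 + w].
have hP : submodP P.
  split=> [|a _ _ [c [w [hc hw ->]]] [c' [w' [hc' hw' ->]]]].
    by exists 0, 0; rewrite !rpred0 scale0r addr0.
  exists (a * c + c'), (a *: w + w'); split.
  - by rewrite (rpredD (V := R^o)) ?(rpredZ (V := R^o)).
  - by rewrite rpredD ?rpredZ.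
  by rewrite scalerDr scalerA scalerDl addrACA.
have hsP u : u \in u0 :: s -> P u.
  move=> /hs hu; apply/(mksubP hP); move: hu; apply: span_min.
  move=> _ [a [t [am /span_cons[c [w [hw ->]]] ->]]]; apply/(mksubP hP).
  exists (a * c), (a *: w); rewrite scalerDr scalerA; split=> //.
    by rewrite mulrC (rpredZ (V := R^o)).
  by apply: mem_span; exists a, w.
have u0Q : u0 \in Q.
  have [a [w [am hw e]]] := hsP u0 (mem_head _ _).
  have [b hb] := local_unit am.
  by rewrite -[u0]scale1r -hb -scalerA rpredZ // scalerBl scale1r {1}e addrC addKr.
have s0 u : u \in s -> u = 0.
  apply: IH => t ts; have [|a [w [am hw ->]]] := hsP t; first by rewrite inE ts orbT.
  by rewrite rpredD ?rpredZ.
have h0 : submodP (fun v : V => v = 0).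
  by split=> // a v w -> ->; rewrite scaler0 addr0.
have u00 : u0 = 0.
  apply/(mksubP h0); move: u0Q; apply: span_min => _ [a [t [_ ht ->]]].
  rewrite rpredZ //; move: ht; apply: span_min => t' /s0 ->; exact: rpred0.
by move=> u; rewrite inE => /orP[/eqP -> //|/s0].
Qed.

Section ScaleVector.
Variables (V : lmodType R) (v : V).
Definition scalev (a : R^o) : V := (a : R) *: v.
Fact scalev_linear : linear scalev.
Proof. by move=> c a b; rewrite /scalev scalerDl scalerA. Qed.
HB.instance Definition _ := GRing.isLinear.Build R R^o V *:%R scalev scalev_linear.
End ScaleVector.

(** The chain of the submodules [m^k v] has a repetition [m^k v = m^(k+1) v],
and then [m^k v = 0] by Nakayama's lemma. *)
Lemma finite_length_torsion (V : lmodType R) : finite_length V ->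
  forall v : V, v \in H0 m idfun V.
Proof.
move=> [b hb] v; apply/mksubP.
pose P k := image_sub (scalev v) (ideal_pow m k).
have [k hk] : exists k, {subset P k <= P k.+1}.
  apply: contrapT => h; suff strict i : (i < b.+1)%N ->
      {subset P (b.+1 - i)%N <= P (b.+1 - i.+1)%N} /\
      ~ {subset P (b.+1 - i.+1)%N <= P (b.+1 - i)%N}.
    by have := hb b.+1 (fun i => P (b.+1 - i)%N) strict; rewrite ltnn.
  move=> ib; rewrite subSS subSn; last by rewrite -ltnS.
  split; last by move=> sub; apply: h; exists (b - i)%N.
  move=> w /mksubP[a ha ->]; apply/mksubP; exists a => //.
  exact: (@pow_sub_anti _ _ _ 1).
have [s hs] := R_noeth (ideal_pow m k); exists k => a ha /=.
pose S := [seq scalev v c | c <- s].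
have kS (c : R^o) : c \in (ideal_pow m k : {pred R^o}) ->
    scalev v c \in Defs.span (fun w => w \in S).
  rewrite hs => hc; suff : c \in comap (scalev v) (Defs.span (fun w => w \in S)).
    by move/mksubP.
  by move: hc; apply: span_min => d ds; apply/mksubP/mem_span/map_f.
have S0 : forall u, u \in S -> u = 0.
  apply: nakayama => u /mapP[c cs ->].
  have : scalev v c \in P k.+1.
    by apply: hk; apply/mksubP; exists c => //; rewrite hs mem_span.
  move=> /mksubP[d hd ->].
  suff : d \in comap (scalev v) (scale_sub m (Defs.span (fun w => w \in S))).
    by move/mksubP.
  move: hd; apply: span_min => _ [e [f [em hf ->]]]; apply/mksubP.
  rewrite linearZ; apply: mem_span; exists e, (scalev v f); split=> //.
  exact: kS.
have h0 : submodP (fun w : V => w = 0).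
  by split=> // c u w -> ->; rewrite scaler0 addr0.
apply/(mksubP h0); have := kS a ha; apply: span_min => u /S0 ->; exact: rpred0.
Qed.

(** As [m^k] is finitely generated, a single power [m^K] kills all the [d v]
with [d] in [m^k], and then [m^(K+k)] kills [v]. *)
Lemma H0_saturated (A : comNzRingType) (phi : {rmorphism R -> A}) (V : lmodType A)
    (v : V) k :
  (forall d, d \in (ideal_pow m k : {pred R^o}) -> phi d *: v \in H0 m phi V) ->
  v \in H0 m phi V.
Proof.
move=> h; have [s hs] := R_noeth (ideal_pow m k).
have [K hK] : exists K, forall d, d \in s ->
    forall c, c \in (ideal_pow m K : {pred R^o}) -> phi c *: (phi d *: v) = 0.
  have : forall d, d \in s -> phi d *: v \in H0 m phi V.
    by move=> d ds; apply: h; rewrite hs mem_span.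
  elim: s {hs} => [|d s IH] hs; first by exists 0%N.
  have /mksubP[n hn] := hs d (mem_head _ _); have [|j hj] := IH.
    by move=> e es; apply: hs; rewrite inE es orbT.
  exists (n + j)%N => e; rewrite inE => /orP[/eqP ->|es] c hc.
    by apply: hn; apply: (@pow_sub_anti _ _ _ j); rewrite addnC.
  by apply: hj => //; apply: (@pow_sub_anti _ _ _ n).
have {}hK d c : d \in (ideal_pow m k : {pred R^o}) ->
    c \in (ideal_pow m K : {pred R^o}) -> phi c *: (phi d *: v) = 0.
  move=> hd hc; have hP : submodP (fun e : R^o => phi c *: (phi (e : R) *: v) = 0).
    split=> [|e e1 e2 h1 h2]; first by rewrite rmorph0 scale0r scaler0.
    rewrite rmorphD scalerDl scalerDr h2 addr0 rmorphM -scalerA scalerA mulrC.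
    by rewrite -scalerA h1 scaler0.
  apply/(mksubP hP); move: hd; rewrite hs; apply: span_min => e es.
  by apply/mksubP; apply: hK.
apply/mksubP; exists (K + k)%N; elim: K v {h} hK => [|K IH] v hK a ha.
  by rewrite -[_ *: v]scale1r -(rmorph1 phi) hK //; apply: mem_sub_full.
have hP : submodP (fun e : R^o => phi (e : R) *: v = 0).
  split=> [|e e1 e2 h1 h2]; first by rewrite rmorph0 scale0r.
  by rewrite rmorphD scalerDl h2 addr0 rmorphM -scalerA h1 scaler0.
apply/(mksubP hP); move: ha; apply: span_min => _ [c [u [cm hu ->]]]; apply/mksubP.
rewrite rmorphM mulrC -scalerA; apply: IH hu => d e hd he.
have ce : (c : R) * e \in (ideal_pow m K.+1 : {pred R^o}).
  by apply: mem_span; exists c, e.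
have := hK d _ hd ce; rewrite !scalerA -!rmorphM => <-; congr (phi _ *: v).
by rewrite [RHS]mulrC mulrA [LHS]mulrC [e * d]mulrC mulrCA mulrA mulrC.
Qed.
End Torsion.
(** * Torsion of graded modules and restriction of complexes *)

Section GradedSubmodules.
Variables (R : comNzRingType) (r : nat).

(** An isomorphism onto a graded submodule. *)
Definition graded_mono (V W : grmod R r) (f : ghom V W) :=
  injective f /\ forall n v, gm_deg n (f v) -> gm_deg n v.

Lemma ghom_factor (V W W' : grmod R r) (f : ghom V W) (g : ghom W' W) :
    graded_mono g -> (forall v, exists w, g w = f v) ->
  exists h : ghom V W', forall v, g (h v) = f v.
Proof.
move=> [ginj gdeg] /choice[h hh].
have hlin : linear h by move=> p u v; apply: ginj; rewrite linearP !hh linearP.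
pose L := GRing.isLinear.Build _ V W' *:%R h hlin.
pose H : {linear V -> W'} := HB.pack h L.
have Hdeg n v : gm_deg n v -> gm_deg n (H v).
  by move=> hv; apply: gdeg; rewrite [g _]hh; apply: gh_deg.
by exists (GHom Hdeg).
Qed.

(** The differentials factor because they preserve the submodules, and their
composites vanish because the inclusions are injective. *)
Lemma complex_restrict (C C' : nat -> grmod R r) (K : gcomplex C)
    (f : forall j, ghom (C' j) (C j)) :
    (forall j, graded_mono (f j)) ->
    (forall j v, exists w, f j w = K j (f j.+1 v)) ->
  exists K' : gcomplex C', forall j v, f j (K' j v) = K j (f j.+1 v).
Proof.
move=> fmono fK.
have ex j : exists d : ghom (C' j.+1) (C' j), forall v, f j (d v) = K j (f j.+1 v).
  have clin : linear (fun v => K j (f j.+1 v)) by move=> p u v; rewrite !linearP.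
  pose L := GRing.isLinear.Build _ (C' j.+1) (C j) *:%R _ clin.
  pose c : {linear C' j.+1 -> C j} := HB.pack (fun v => K j (f j.+1 v)) L.
  have cdeg n v : gm_deg n v -> gm_deg n (c v) by move=> hv; do 2 apply: gh_deg.
  by have [d hd] := @ghom_factor _ _ _ (GHom cdeg) _ (fmono j) (fK j); exists d.
pose d j := projT1 (cid (ex j)).
have hd j v : f j (d j v) = K j (f j.+1 v) by apply: (projT2 (cid (ex j))).
have dd j v : d j (d j.+1 v) = 0.
  by apply: (proj1 (fmono j)); rewrite !hd gc_dd linear0.
by exists (GComplex dd).
Qed.

Variable m : idealT R.

Lemma H0_incl_mono (V : grmod R r) : graded_mono (H0_incl m V).
Proof. by split=> // u v; apply: val_inj. Qed.

Lemma H0S_ghom (V W : grmod R r) (f : ghom V W) v : v \in H0S m V -> f v \in H0S m W.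
Proof.
by move=> hv; apply: (H0_map_mem f (exist (fun u => u \in H0S m V) v hv)).
Qed.

Variable s : nat.

Lemma tens_mapE (N N' : lmodType R) (g : {linear N -> N'}) (f : tens r s N) a :
  (tens_map r s g f : dsum _) a = g ((f : dsum _) a).
Proof.
move: f; apply: ds_ind => [|u v eu ev|b v].
- by rewrite !linear0.
- by rewrite (linearD (tens_map r s g)) !dsDE eu ev linearD.
rewrite [X in (X : dsum _) a](tens_map_funE g b v) [ds_in v]/(mon_in N b v) !mon_inE.
by case: ifP; rewrite ?linear0.
Qed.

Variable N : lmodType R.

(** An element of [N (x) S] has finitely many nonzero coefficients, so that a
power of [m] killing each of them can be chosen in common. *)
Lemma H0S_tens (z : tens r s N) :
  z \in H0S m (tens r s N) <-> forall a, (z : dsum _) a \in H0 m idfun N.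
Proof.
split=> [/mksubP[k hk] a|hz].
  apply/mksubP; exists k => c /hk e.
  have : (c%:MP_[r] *: z : dsum _) a = 0 by rewrite e.
  by rewrite [X in (X : dsum _) a]polymodC.
have [K hK] : exists K, forall a c, a \in ds_supp (z : dsum _) ->
    c \in (ideal_pow m K : {pred R^o}) -> (c : R) *: (z : dsum _) a = 0.
  elim: (ds_supp _) => [|a t [K hK]]; first by exists 0%N.
  have /mksubP[n hn] := hz a; exists (n + K)%N => b c.
  rewrite inE => /orP[/eqP ->|bt] hc; last exact: hK (pow_sub_anti hc).
  by apply: hn; apply: (@pow_sub_anti _ _ _ K); rewrite addnC.
apply/mksubP; exists K => c hc; rewrite [LHS]polymodC.
apply: dsum_ext => a; rewrite dsZE.
have [ha|ha] := boolP (a \in ds_supp (z : dsum _)); first exact: hK.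
by rewrite (ds_suppN ha) scaler0.
Qed.

Lemma tens_H0_inclE (z : tens r s (H0R m N)) a :
  (tens_H0_incl m r s N z : dsum _) a = val ((z : dsum _) a).
Proof. exact: tens_mapE. Qed.

Lemma tens_H0_incl_mono : graded_mono (tens_H0_incl m r s N).
Proof.
split=> [u v e|n v hv i hi].
  by apply: dsum_ext => a; apply: val_inj; rewrite -!tens_H0_inclE e.
apply: val_inj; rewrite -[LHS]tens_H0_inclE; exact: hv.
Qed.

Lemma tens_H0_image (z : tens r s N) :
  z \in H0S m (tens r s N) <-> exists w, tens_H0_incl m r s N w = z.
Proof.
split=> [/H0S_tens hz|[w <-]]; last first.
  by apply/H0S_tens => a; rewrite tens_H0_inclE; apply: valP.
pose w a : H0R m N := exist (fun v => v \in H0 m idfun N) _ (hz a).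
have fin : exists t : seq 'X_{1..r}, forall a, a \notin t -> w a = 0.
  by have [t ht] := ds_finite z; exists t => a /ht e; apply: val_inj.
by exists (DSum fin); apply: dsum_ext => a; rewrite tens_H0_inclE.
Qed.
End GradedSubmodules.

(** * The complexes of torsion submodules *)

Section TorsionComplexes.
Variables (R : comNzRingType) (m : idealT R) (M : lmodType R) (r : nat) (x : 'I_r -> R).

Lemma lc_incl_mono j : graded_mono (lc_incl m x M j).
Proof. by case: j => [|i]; [exact: H0_incl_mono | exact: tens_H0_incl_mono]. Qed.

Lemma lc_incl_image j v :
  v \in H0S m (apx_term x M j) <-> exists w, lc_incl m x M j w = v.
Proof.
case: j v => [|i] v; last exact: tens_H0_image.
by split=> [hv|[w <-]]; [exists (exist (fun u => u \in H0S m _) v hv) | exact: valP].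
Qed.

Lemma H0_approx_complex :
  exists (K : gcomplex (lc_term m x M))
          (phi : forall j, ghom (lc_term m x M j) (H0_gr m (apx_term x M j))),
     [/\ forall j, bijective (phi j),
         forall j v, H0_incl m (apx_term x M j) (phi j v) = lc_incl m x M j v
       & forall j v,
           phi j (K j v) = H0_complex m (approx_complex x M) j (phi j.+1 v)].
Proof.
have [j v|K hK] := complex_restrict (K := approx_complex x M) lc_incl_mono.
  by apply/lc_incl_image/H0S_ghom/lc_incl_image; exists v.
have ex j : exists f : ghom (lc_term m x M j) (H0_gr m (apx_term x M j)),
    forall v, H0_incl m (apx_term x M j) (f v) = lc_incl m x M j v.
  apply: (ghom_factor (H0_incl_mono m _)) => v.
  have hv : lc_incl m x M j v \in H0S m (apx_term x M j) by apply/lc_incl_image; exists v.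
  by exists (exist (fun u => u \in H0S m _) _ hv).
pose phi j := projT1 (cid (ex j)).
have hphi j v : H0_incl m (apx_term x M j) (phi j v) = lc_incl m x M j v.
  exact: (projT2 (cid (ex j))).
exists K, phi; split=> // [j|j v]; last first.
  by apply: val_inj; rewrite -[LHS]/(H0_incl m _ _) hphi hK -hphi.
have /choice[g hg] (v : H0_gr m (apx_term x M j)) : exists w, phi j w = v.
  have /lc_incl_image[w hw] := valP v.
  by exists w; apply: val_inj; rewrite -[LHS]/(H0_incl m _ _) hphi.
exists g => // w; apply: (proj1 (lc_incl_mono j)); rewrite -!hphi.
by rewrite hg.
Qed.

Hypothesis R_noeth : noetherian R.
Hypothesis R_local : local_ring m.
Hypothesis x_amen : amenable x M.

Lemma khom_torsion i (z : tens r i.+1 (khom x M i.+1)) : z \in H0S m (tens r i.+1 _).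
Proof.
apply/H0S_tens => a; apply: finite_length_torsion => //.
exact: x_amen.
Qed.

Lemma am_incl_mono j : graded_mono (am_incl m x M j).
Proof.
by case: j => [|[|i]]; [exact: H0_incl_mono | exact: tens_H0_incl_mono | split].
Qed.

Lemma am_incl_image j v :
  v \in H0S m (apx_term x M j) <-> exists w, am_incl m x M j w = v.
Proof.
case: j v => [|[|i]] v; [exact: (lc_incl_image (j := 0)) | exact: tens_H0_image |].
by split=> [_|_]; [exists v | exact: khom_torsion].
Qed.

Hypothesis x_dseq : d_sequence x M.

(** The kernel of the augmentation is the image of a torsion module, so an
element of [H_0 (x) S] over a torsion element of [gr] is itself torsion. *)
Lemma am_aug_surj w : w \in H0S m (gr x M) ->
  exists2 v, v \in H0S m (tens r 0 (khom x M 0)) & aug x M v = w.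
Proof.
have [v <-] := aug_surj w; move=> /mksubP[k hk]; exists v => //.
apply: (H0_saturated R_noeth (k := k)) => d hd.
have [u ->] : exists u, d%:MP_[r] *: v = apx_d x M 0 u.
  by apply: aug_exact => //; rewrite linearZ; apply: hk.
exact/H0S_ghom/khom_torsion.
Qed.

Lemma am_complex_acyclic : (0 < r)%N ->
  exists K : gcomplex (am_term m x M),
     (forall j v,
        am_incl m x M j (K j v) = approx_complex x M j (am_incl m x M j.+1 v)) /\
     acyclic r K.
Proof.
move=> r0; have [j v|K hK] := complex_restrict (K := approx_complex x M) am_incl_mono.
  by apply/am_incl_image/H0S_ghom/am_incl_image; exists v.
have inj j := proj1 (am_incl_mono j).
exists K; split=> //; split=> [w|j _ v e|u v e].
- have [u hu eu] := am_aug_surj (valP w).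
  have /(am_incl_image (j := 1))[v ev] := hu; exists v; apply: (inj 0%N).
  by rewrite hK ev.
- have [|w0 ew] := @approx_exact _ _ x M x_dseq j (am_incl m x M j.+1 v).
    by rewrite -hK e linear0.
  have [w hw] : exists w, am_incl m x M j.+2 w = w0 by exists w0.
  by exists w; apply: inj; rewrite hK hw.
apply: (inj r.+1); apply: (approx_inj x_dseq r0); by rewrite -!hK e.
Qed.
End TorsionComplexes.

Theorem theorem3p2 (R : comNzRingType) (m : idealT R) (M : lmodType R)
    (d r : nat) (x : 'I_r -> R)
    (R_noetherian : noetherian R)
    (R_local : local_ring m)
    (M_finite : finite_module M)
    (M_dim : has_dim M d)
    (d_gt0 : (0 < d)%N)
    (r_gt0 : (0 < r)%N)
    (r_le_d : (r <= d)%N)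
    (x_sop : partial_sop x M m)
    (x_dseq : d_sequence x M) :
  (exists (K : gcomplex (lc_term m x M))
          (phi : forall j, ghom (lc_term m x M j) (H0_gr m (apx_term x M j))),
     [/\ forall j, bijective (phi j),
         forall j v, H0_incl m (apx_term x M j) (phi j v) = lc_incl m x M j v
       & forall j v,
           phi j (K j v) = H0_complex m (approx_complex x M) j (phi j.+1 v)])
  /\
  (amenable x M ->
   exists K : gcomplex (am_term m x M),
     (forall j v,
        am_incl m x M j (K j v) = approx_complex x M j (am_incl m x M j.+1 v)) /\
     acyclic r K).
Proof.
split; first exact: H0_approx_complex.
by move=> x_amen; apply: am_complex_acyclic.
Qed.
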